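(* Let $\Phi_4$ be the root system of type $F_4$, let $q$ be a power of a prime $p>2$, and let $UF_4=UF_4(q)$. Use the numbering of roots, arms $a(\alpha)$ and groups $S_\alpha$, $\overline{T}_\alpha$ specified in the context, and let $R_4^{\mathrm{normal}}=\Phi_4^+\setminus\{\alpha_{20},\alpha_{22}\}$. For each positive root $\alpha\in\Phi_4^+$: (a) If $\alpha\in\Phi_4^+\setminus R_4^{\mathrm{normal}}$ then $\Psi_\alpha:\operatorname{Irr}^{\mathrm{lin}}(\overline{T}_\alpha)\times\operatorname{Irr}(X_\alpha)^*\to\operatorname{Irr}^{\mathrm{mida}}(UF_4)_\alpha$, $(\mu,\lambda)\mapsto(\operatorname{Infl}_{\overline{T}_\alpha}^{S_\alpha}\mu\cdot\operatorname{Infl}_{X_\alpha}^{S_\alpha}\lambda)^{UF_4}$, is a one to one correspondence. (b) If $\alpha\in R_4^{\mathrm{normal}}$ then $\Psi_\alpha:\operatorname{Irr}(\overline{T}_\alpha)\times\operatorname{Irr}(X_\alpha)^*\to\operatorname{Irr}(UF_4)_\alpha$, $(\mu,\lambda)\mapsto(\operatorname{Infl}_{\overline{T}_\alpha}^{S_\alpha}\mu\cdot\operatorname{Infl}_{X_\alpha}^{S_\alpha}\lambda)^{UF_4}$, is a one to one correspondence. Moreover, for $\alpha=\alpha_m$ one has $|\operatorname{Irr}^{\mathrm{mida}}(UF_4)_\alpha|=q^c(q-1)$ and $\chi(1)=q^d$ for all $\chi\in\operatorname{Irr}^{\mathrm{mida}}(UF_4)_\alpha$, where $m:(c,d)$ is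 given by: $1$–$4$: $(0,0)$; $5$–$7$: $(0,1)$; $8:(1,2)$; $9:(1,1)$; $10:(1,2)$; $11:(3,2)$; $12:(2,3)$; $13:(1,3)$; $14:(2,3)$; $15:(5,4)$; $16:(2,2)$; $17:(4,5)$; $18:(4,3)$; $19:(3,6)$; $20:(4,4)$; $21:(3,7)$; $22:(4,5)$; $23:(4,6)$; $24:(3,7)$.
   Context: General notation. For an irreducible root system $\Phi$ with positive roots $\Phi^+$ let $X_\gamma=\{x_\gamma(t)\mid t\in\mathbb{F}_q\}$ be the root subgroups of the untwisted Chevalley group over $\mathbb{F}_q$ of that type, and $U=\langle X_\gamma\mid\gamma\in\Phi^+\rangle$ (denoted $UF_4$ for type $F_4$). Write $\beta\preceq\alpha$ if $\alpha-\beta$ is $0$ or a sum of positive roots. $S\subseteq\Phi^+$ is a closed pattern if $\beta,\gamma\in S$, $\beta+\gamma\in\Phi^+$ imply $\beta+\gamma\in S$; then $P(S)=\langle X_\gamma\mid\gamma\in S\rangle$. For $N\subseteq S$, $S$ a closed pattern, $N\unlhd S$ means: $\beta\in N,\gamma\in S,\beta+\gamma\in\Phi^+$ imply $\beta+\gamma\in N$ (then $P(N)$ is normal in $P(S)$); the normal closure of $M\subseteq S$ in $S$ is the smallest $N\unlhd S$ containing $M$. $k(\alpha)=\{\beta\in\Phi^+\mid\beta\not\preceq\alpha\}$ (the largest $N\unlhd\Phi^+$ not containing $\alpha$); $h(\alpha)=\{\gamma\in\Phi^+\mid\alpha-\gamma\in\Phi^+\cup\{0\}\}$. Given an arm $a(\alpha)\subset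 h(\alpha)\setminus\{\alpha\}$ (containing exactly one of $\gamma,\alpha-\gamma$ for each $\gamma\in h(\alpha)\setminus\{\alpha\}$), the leg is $\ell(\alpha)=\{\alpha-\gamma\mid\gamma\in a(\alpha)\}$ and the source $s(\alpha)=\Phi^+\setminus a(\alpha)$. With the arms below, $s(\alpha)$ is a closed pattern and $S_\alpha=P(s(\alpha))$. If $\alpha\in R_4^{\mathrm{normal}}$, then $\ell(\alpha)\cup k(\alpha)\unlhd s(\alpha)$ and $\overline{T}_\alpha=S_\alpha/P(\{\alpha\}\cup\ell(\alpha)\cup k(\alpha))$. If $\alpha\notin R_4^{\mathrm{normal}}$, let $\bar{\ell}(\alpha)=M\setminus k(\alpha)$ with $M$ the normal closure of $\ell(\alpha)\cup k(\alpha)$ in $s(\alpha)$, and $\overline{T}_\alpha=S_\alpha/P(\{\alpha\}\cup\bar{\ell}(\alpha)\cup k(\alpha))$. The group $X_\alpha$ is identified with $S_\alpha/P(s(\alpha)\setminus\{\alpha\})$ and $\operatorname{Infl}_{X_\alpha}^{S_\alpha}$ is inflation along this quotient. $\operatorname{Irr}(G)$: complex irreducible characters; $\operatorname{Irr}^{\mathrm{lin}}(G)$: those of degree 1; $\operatorname{Irr}(G)^*=\operatorname{Irr}(G)\setminus\{\mathbf 1_G\}$; $\lambda^U$: induction. $\operatorname{rs}(\chi)=\{\gamma\in\Phi^+\mid X_\gamma\subseteq Z(\chi),X_\gamma\not\subseteq\ker\chi\}$; $\operatorname{Irr}(U)_\alpha=\{\chi\in\operatorname{Irr}(U)\mid\operatorname{rs}(\chi)=\{\alpha\}\}$;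 $\operatorname{Irr}^{\mathrm{mida}}(U)_\alpha$: the elements of minimal degree in $\operatorname{Irr}(U)_\alpha$. Roots. With $e_1,\dots,e_4$ orthonormal, the simple roots are $\alpha_1=e_2-e_3$, $\alpha_2=e_3-e_4$, $\alpha_3=e_4$, $\alpha_4=\frac12(e_1-e_2-e_3-e_4)$. The positive roots $\alpha_1,\dots,\alpha_{24}$, with coefficient vectors $(m_1m_2m_3m_4)$ in the simple roots: $\alpha_5=1100$, $\alpha_6=0110$, $\alpha_7=0011$, $\alpha_8=1110$, $\alpha_9=0120$, $\alpha_{10}=0111$, $\alpha_{11}=1120$, $\alpha_{12}=1111$, $\alpha_{13}=0121$, $\alpha_{14}=1220$, $\alpha_{15}=1121$, $\alpha_{16}=0122$, $\alpha_{17}=1221$, $\alpha_{18}=1122$, $\alpha_{19}=1231$, $\alpha_{20}=1222$, $\alpha_{21}=1232$, $\alpha_{22}=1242$, $\alpha_{23}=1342$, $\alpha_{24}=2342$. Arms: for each $m$ the indices $j$ of the roots $\alpha_j\in a(\alpha_m)$. 1–4: empty. 5: 2. 6: 3. 7: 4. 8: 1,3. 9: 3. 10: 2,4. 11: 1,3. 12: 1,4,7. 13: 3,4,7. 14: 2,5,6. 15: 1,3,4,7. 16: 4,7. 17: 2,4,5,6,8. 18: 1,4,7. 19: 3,6,7,8,9,10. 20: 2,4,5,10. 21: 3,4,6,7,8,10,13. 22: 3,7,9,11,13. 23: 2,6,9,10,13,16. 24: 1,5,8,11,12,14,15. *)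

(* Defs.v *)
From mathcomp Require Import all_boot all_order all_algebra all_fingroup all_solvable.
From mathcomp Require Import all_field all_character.

Set Implicit Arguments.
Unset Strict Implicit.
Unset Printing Implicit Defensive.

Import GroupScope Order.TTheory GRing.Theory Num.Theory.
Local Open Scope ring_scope.

(** * The root system of type F4 *)

(* Vectors of the root lattice, as coefficients in the simple roots. *)
Notation lattice := (int * int * int * int)%type.

Definition pos_roots : seq lattice :=
  [:: (1, 0, 0, 0); (0, 1, 0, 0); (0, 0, 1, 0); (0, 0, 0, 1);
      (1, 1, 0, 0); (0, 1, 1, 0); (0, 0, 1, 1); (1, 1, 1, 0);
      (0, 1, 2, 0); (0, 1, 1, 1); (1, 1, 2, 0); (1, 1, 1, 1);
      (0, 1, 2, 1); (1, 2, 2, 0); (1, 1, 2, 1); (0, 1, 2, 2);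
      (1, 2, 2, 1); (1, 1, 2, 2); (1, 2, 3, 1); (1, 2, 2, 2);
      (1, 2, 3, 2); (1, 2, 4, 2); (1, 3, 4, 2); (2, 3, 4, 2)].

Definition all_roots : seq lattice := pos_roots ++ [seq - r | r <- pos_roots].

(* A positive root is an index; numbering starts at 0, so that alpha_m is the
   element of 'I_24 with value m - 1. *)
Notation posroot := 'I_24.

Definition coef (a : posroot) : lattice := nth 0 pos_roots a.

(* Coordinates of 2 v in the orthonormal basis e_1, ..., e_4, obtained from
   alpha_1 = e_2 - e_3, alpha_2 = e_3 - e_4, alpha_3 = e_4 and
   alpha_4 = (e_1 - e_2 - e_3 - e_4) / 2. *)
Definition dbl_coord (v : lattice) : lattice :=
  let: (m1, m2, m3, m4) := v in
  (m4, m1 *+ 2 - m4, m2 *+ 2 - m1 *+ 2 - m4, m3 *+ 2 - m2 *+ 2 - m4).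

(* Four times the inner product. *)
Definition ip4 (v w : lattice) : int :=
  let: (v1, v2, v3, v4) := dbl_coord v in
  let: (w1, w2, w3, w4) := dbl_coord w in
  v1 * w1 + v2 * w2 + v3 * w3 + v4 * w4.

(* Twice the vectors +-e_i, +-e_i +- e_j (i < j) and (+-e_1 +-e_2 +-e_3 +-e_4)/2. *)
Definition F4_dbl : seq lattice :=
  let r := [:: -2; -1; 0; 1; 2] in
  let r2 := [seq (x, y) | x <- r, y <- r] in
  let r4 := [seq (xyz, t) | xyz <- [seq (xy, z) | xy <- r2, z <- r], t <- r] in
  [seq v <- r4 |
    let: (x, y, z, t) := v in
    let n := x ^+ 2 + y ^+ 2 + z ^+ 2 + t ^+ 2 in
    if all odd [:: absz x; absz y; absz z; absz t] then n == 4
    else all (predC odd) [:: absz x; absz y; absz z; absz t] && (n \in [:: 4; 8])].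

Lemma all_roots_F4 : perm_eq [seq dbl_coord r | r <- all_roots] F4_dbl.
Proof. by vm_compute. Qed.

(* <s, r^vee> = 2 (s, r) / (r, r) *)
Definition cartan (s r : lattice) : int := ((ip4 s r *+ 2) %/ ip4 r r)%Z.

(* beta <= alpha: the difference is 0 or a sum of positive roots, see precP. *)
Definition prec (b a : posroot) : bool :=
  let: (m1, m2, m3, m4) := coef a - coef b in
  [&& 0 <= m1, 0 <= m2, 0 <= m3 & 0 <= m4].

Lemma precP (b a : posroot) :
  reflect (exists s : seq posroot, coef a - coef b = \sum_(g <- s) coef g) (prec b a).
Proof.
have mulv (m : nat) (v : lattice) :
    v *+ m = (v.1.1.1 *+ m, v.1.1.2 *+ m, v.1.2 *+ m, v.2 *+ m).
  by case: v => [[[x y] z] t] /=; elim: m => // m IHm; rewrite !mulrS IHm.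
rewrite /prec; case: (coef a - coef b) => [[[m1 m2] m3] m4].
apply: (iffP idP) => [/and4P[]|[s]].
  case: m1 m2 m3 m4 => [m1|//] [m2|//] [m3|//] [m4|//] _ _ _ _.
  exists (nseq m1 (inord 0) ++ nseq m2 (inord 1)
          ++ nseq m3 (inord 2) ++ nseq m4 (inord 3)).
  rewrite !big_cat !big_nseq !iter_addr_0 /= /coef !inordK //= !mulv /= !mul0rn.
  by congr (_, _, _, _); rewrite /= ?add0r ?addr0 natz.
have coef_ge0 (g : posroot) :
    [&& 0 <= (coef g).1.1.1, 0 <= (coef g).1.1.2, 0 <= (coef g).1.2 & 0 <= (coef g).2].
  have /allP : all (fun v : lattice =>
      [&& 0 <= v.1.1.1, 0 <= v.1.1.2, 0 <= v.1.2 & 0 <= v.2]) pos_roots by [].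
  by apply; apply: mem_nth.
elim: s m1 m2 m3 m4 => [|g s IHs] m1 m2 m3 m4; first by rewrite big_nil => -[-> -> -> ->].
rewrite big_cons; case: (\sum_(_ <- s) _) IHs => [[[n1 n2] n3] n4] IHs.
case: (coef g) (coef_ge0 g) => [[[k1 k2] k3] k4] /= /and4P[p1 p2 p3 p4].
have /and4P[q1 q2 q3 q4] := IHs _ _ _ _ erefl.
by case=> -> -> -> ->; rewrite !addr_ge0.
Qed.

(** * Patterns *)

Definition is_sum (b g d : posroot) : bool := coef d == coef b + coef g.

Definition closed_pattern (S : {set posroot}) : bool :=
  [forall b in S, forall g in S, forall d, is_sum b g d ==> (d \in S)].

Definition pattern_normal (N S : {set posroot}) : bool :=
  (N \subset S) &&
  [forall b in N, forall g in S, forall d, is_sum b g d ==> (d \in N)].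

Definition normal_closure (M S : {set posroot}) : {set posroot} :=
  \bigcap_(N : {set posroot} | pattern_normal N S && (M \subset N)) N.

Definition kset (a : posroot) : {set posroot} := [set b | ~~ prec b a].

Definition hook (a : posroot) : {set posroot} :=
  [set g | (coef a - coef g == 0) || (coef a - coef g \in pos_roots)].

(* Entry m - 1 lists the indices j such that alpha_j is in the arm of alpha_m. *)
Definition arm_table : seq (seq nat) :=
  [:: [::]; [::]; [::]; [::]; [:: 2]; [:: 3]; [:: 4]; [:: 1; 3]; [:: 3];
      [:: 2; 4]; [:: 1; 3]; [:: 1; 4; 7]; [:: 3; 4; 7]; [:: 2; 5; 6];
      [:: 1; 3; 4; 7]; [:: 4; 7]; [:: 2; 4; 5; 6; 8]; [:: 1; 4; 7];
      [:: 3; 6; 7; 8; 9; 10]; [:: 2; 4; 5; 10]; [:: 3; 4; 6; 7; 8; 10; 13];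
      [:: 3; 7; 9; 11; 13]; [:: 2; 6; 9; 10; 13; 16];
      [:: 1; 5; 8; 11; 12; 14; 15]]%N.

Definition arm (a : posroot) : {set posroot} :=
  [set b : posroot | (b : nat).+1 \in nth [::] arm_table a].

Definition leg (a : posroot) : {set posroot} :=
  [set b | [exists g in arm a, coef b == coef a - coef g]].

Definition source (a : posroot) : {set posroot} := ~: arm a.

Lemma arm_hook (a : posroot) : arm a \subset hook a :\ a.
Proof.
have chk : all (fun m => all (fun j => (j.+1 \in nth [::] arm_table m) ==>
    ((j != m) && (nth 0 pos_roots m - nth 0 pos_roots j \in pos_roots)))
    (iota 0 24)) (iota 0 24) by vm_compute.
apply/subsetP => b; rewrite in_setD1 2!in_set -(inj_eq val_inj) /coef => hb.
have ia (c : posroot) : (c : nat) \in iota 0 24 by rewrite mem_iota ltn_ord.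
move: (allP (allP chk _ (ia a)) _ (ia b)) => {chk} /implyP/(_ hb)/andP[ne hk].
by rewrite ne hk orbT.
Qed.

Lemma arm_leg (a b g : posroot) : is_sum b g a -> (b \in arm a) (+) (g \in arm a).
Proof.
have chk : all (fun m => all (fun i => all (fun j =>
    (nth 0 pos_roots m == nth 0 pos_roots i + nth 0 pos_roots j) ==>
    ((i.+1 \in nth [::] arm_table m) (+) (j.+1 \in nth [::] arm_table m)))
    (iota 0 24)) (iota 0 24)) (iota 0 24) by vm_compute.
have ia (c : posroot) : (c : nat) \in iota 0 24 by rewrite mem_iota ltn_ord.
by move: (allP (allP (allP chk _ (ia a)) _ (ia b)) _ (ia g)) => {chk} /implyP; rewrite !in_set.
Qed.

Lemma source_closed (a : posroot) : closed_pattern (source a).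
Proof.
have chk : all (fun i => all (fun j => all (fun k =>
    (nth 0 pos_roots k == nth 0 pos_roots i + nth 0 pos_roots j) ==>
    all (fun t : seq nat => (i.+1 \notin t) ==> (j.+1 \notin t) ==> (k.+1 \notin t))
      arm_table) (iota 0 24)) (iota 0 24)) (iota 0 24) by vm_compute.
apply/forall_inP => b hb; apply/forall_inP => g hg; apply/forallP => d; apply/implyP => hd.
have ia (c : posroot) : (c : nat) \in iota 0 24 by rewrite mem_iota ltn_ord.
move: (allP (allP (allP chk _ (ia b)) _ (ia g)) _ (ia d)) => {chk}.
move=> /implyP/(_ hd)/allP/(_ (nth [::] arm_table a)).
rewrite mem_nth ?ltn_ord // => /(_ isT); rewrite !(in_setC, in_set) in hb hg *.
by rewrite hb hg.
Qed.

Definition R4normal : {set posroot} :=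
  [set a : posroot | (a : nat).+1 \notin [:: 20; 22]%N].

Definition legbar (a : posroot) : {set posroot} :=
  normal_closure (leg a :|: kset a) (source a) :\: kset a.

(** * A Chevalley basis of the Lie algebra of type F4 *)

(* The Lie algebra of type F4 is the fixed point algebra of the diagram
   automorphism of the one of type E6.  A vector (m1, m2, a, a', b, b') of the
   E6 lattice refers to the diagram

                        m1
                        |
               b -- a - m2 - a' -- b'

   and restricts to (m1, m2, a + a', b + b') in the F4 lattice.  For the E6
   roots x, y with basis vectors E_x, E_y take [E_x, E_y] = eps(x, y) E_(x+y),
   with eps the bimultiplicative sign attached to the orientation of the diagram
   away from m2 and from m1 to m2; it is invariant under the automorphism. *)
Notation latticeE6 := (int * int * int * int * int * int)%type.

Definition normE6 (x : latticeE6) : int :=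
  let: (m1, m2, a, a', b, b') := x in
  (m1 ^+ 2 + m2 ^+ 2 + a ^+ 2 + a' ^+ 2 + b ^+ 2 + b' ^+ 2
   - m1 * m2 - m2 * a - m2 * a' - a * b - a' * b') *+ 2.

Definition epsE6 (x y : latticeE6) : int :=
  let: (m1, m2, a, a', b, b') := x in
  let: (n1, n2, c, c', d, d') := y in
  (-1) ^+ absz (m1 * n1 + m2 * n2 + a * c + a' * c' + b * d + b' * d'
                + m1 * n2 + m2 * c + m2 * c' + a * d + a' * d').

(* The orbit of E6 roots restricting to the root r of F4. *)
Definition orbE6 (r : lattice) : seq latticeE6 :=
  let: (m1, m2, m3, m4) := r in
  let halves (m : int) := undup [:: (m %/ 2)%Z; m - (m %/ 2)%Z] in
  [seq x <- [seq (m1, m2, a, m3 - a, b, m4 - b) | a <- halves m3, b <- halves m4]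
     | normE6 x == 2].

(* e_r is the sum of the E_x over x in orbE6 r if r is positive, minus this sum
   if r is negative. *)
Definition sgn_root (r : lattice) : int := if r \in pos_roots then 1 else -1.

(* [e_r, e_s] = Nconst r s e_(r+s) if r, s and r + s are roots. *)
Definition Nconst (r s : lattice) : int :=
  let z := head 0 (orbE6 (r + s)) in
  sgn_root r * sgn_root s * sgn_root (r + s) *
  foldr +%R 0 [seq epsE6 x y | x <- orbE6 r, y <- [seq y <- orbE6 s | x + y == z]].

(* The r-string through s is s - p r, ..., s + p' r. *)
Definition string_len (r s : lattice) : nat :=
  find (fun i => s - r *+ i.+1 \notin all_roots) (iota 0 4).

Lemma NconstE :
  all (fun rs => (rs.1 + rs.2 \in all_roots) ==>
         ((absz (Nconst rs.1 rs.2) == (string_len rs.1 rs.2).+1)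
          && (Nconst (- rs.1) (- rs.2) == - Nconst rs.1 rs.2)))
      [seq (r, s) | r <- all_roots, s <- all_roots].
Proof. by vm_compute. Qed.

(* The coordinate of the coroot r^vee at the simple coroot alpha_(k+1)^vee. *)
Definition coroot (r : lattice) (k : nat) : int :=
  let: (m1, m2, m3, m4) := r in
  let b := nth 0 pos_roots k in
  ((nth 0 [:: m1; m2; m3; m4] k * ip4 b b) %/ ip4 r r)%Z.

(* The Chevalley basis: indices 0, ..., 3 are the simple coroots h_1, ..., h_4,
   the index 4 + j stands for e_r, with r entry j of all_roots. *)
Definition wt (i : nat) : lattice := if (i < 4)%N then 0 else nth 0 all_roots (i - 4).

(* The coefficient at basis vector k of the bracket of basis vectors i and j. *)
Definition lie_const (i j k : nat) : int :=
  let r := wt i in let s := wt j in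
  if (i < 4)%N then
    if (j < 4)%N then 0 else if k == j then cartan s (nth 0 pos_roots i) else 0
  else if (j < 4)%N then if k == i then - cartan r (nth 0 pos_roots j) else 0
  else if r + s == 0 then if (k < 4)%N then coroot r k else 0
  else if (4 <= k)%N && (wt k == r + s) then Nconst r s else 0.

Lemma wt_root (n : nat) : (4 <= n < 52)%N -> wt n \in all_roots.
Proof.
suff: all (fun n => wt n \in all_roots) (iota 4 48).
  by move=> /allP H hn; apply: H; rewrite mem_iota.
by vm_compute.
Qed.

Lemma bracket_antisym (r s : lattice) : r \in all_roots -> s \in all_roots ->
  if r + s == 0 then all (fun k => coroot r k == - coroot s k) (iota 0 4)
  else (r + s \in all_roots) ==> (Nconst r s == - Nconst s r).
Proof.
move: r s; suff H : all (fun r => all (fun s =>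
    if r + s == 0 then all (fun k => coroot r k == - coroot s k) (iota 0 4)
    else (r + s \in all_roots) ==> (Nconst r s == - Nconst s r)) all_roots) all_roots.
  by move=> r s hr hs; apply: (allP (allP H r hr) s hs).
by vm_compute.
Qed.

Lemma lie_antisym (i j k : nat) :
  (i < 52)%N -> (j < 52)%N -> (k < 52)%N -> lie_const i j k = - lie_const j i k.
Proof.
move=> Hi Hj Hk; rewrite /lie_const.
case: (ltnP i 4) => hi; case: (ltnP j 4) => hj; rewrite ?oppr0 //.
- by case: ifP; rewrite ?opprK ?oppr0.
- by case: ifP; rewrite ?opprK ?oppr0.
have ri : wt i \in all_roots by apply: wt_root; rewrite hi.
have rj : wt j \in all_roots by apply: wt_root; rewrite hj.
have := bracket_antisym ri rj; rewrite [wt j + wt i]addrC; case: ifP => _.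
  case: ifP => hk; rewrite ?oppr0 // => /allP/(_ k).
  by rewrite mem_iota => /(_ hk)/eqP.
case: ifP => [/andP[hk /eqP e]|]; rewrite ?oppr0 // => /implyP H.
by apply/eqP/H; rewrite -e wt_root // hk.
Qed.

Lemma lie_jacobi (i j k l : nat) :
  (i < 52)%N -> (j < 52)%N -> (k < 52)%N -> (l < 52)%N ->
  \sum_(m < 52) (lie_const i j m * lie_const m k l + lie_const j k m * lie_const m i l
                 + lie_const k i m * lie_const m j l) = 0.
Proof.
pose sp i j := [seq p <- [seq (m, lie_const i j m) | m <- iota 0 52] | p.2 != 0].
pose co l v := foldr (fun (p : nat * int) a => if p.1 == l then p.2 + a else a) 0 v.
pose mul (b : nat -> nat -> seq (nat * int)) i j k :=
  flatten [seq [seq (q.1, p.2 * q.2) | q <- b p.1 k] | p <- b i j].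
pose jac b i j k := mul b i j k ++ mul b j k i ++ mul b k i j.
pose look (t : seq (seq (seq (nat * int)))) i j := nth [::] (nth [::] t i) j.
pose mk (f : nat -> nat -> seq (nat * int)) :=
  mkseq (fun i => mkseq (f i) 52) 52.
have mkE f x y : (x < 52)%N -> (y < 52)%N -> look (mk f) x y = f x y.
  by move=> hx hy; rewrite /look !nth_mkseq.
pose tab := mk sp.
have inI n : (n < 52)%N -> n \in iota 0 52 by rewrite mem_iota.
have bE x y : (x < 52)%N -> (y < 52)%N -> look tab x y = sp x y by exact: mkE.
have coE l' v : co l' v = \sum_(p <- v | p.1 == l') p.2.
  by elim: v => [|p v IHv]; rewrite ?big_nil // big_cons /= IHv.
have spE x y z : (z < 52)%N -> \sum_(p <- sp x y | p.1 == z) p.2 = lie_const x y z.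
  move=> hz; rewrite big_filter_cond big_map /=.
  under eq_bigl do rewrite andbC.
  rewrite big_mkcondr -big_filter filter_pred1_uniq ?iota_uniq ?inI // big_seq1.
  by case: eqP.
move=> hi hj hk hl.
have mulE b x y z :
    (forall x y, (x < 52)%N -> (y < 52)%N -> b x y = sp x y) ->
    (x < 52)%N -> (y < 52)%N -> (z < 52)%N ->
    co l (mul b x y z) = \sum_(m < 52) lie_const x y m * lie_const m z l.
  move=> bE' hx hy hz; rewrite coE /mul bE' // big_flatten big_map /=.
  rewrite big_filter big_map /= big_mkcond /= -(big_mkord xpredT (fun m => lie_const x y m * lie_const m z l)).
  rewrite /index_iota subn0 big_seq [RHS]big_seq; apply: eq_bigr => m.
  rewrite -[X in m \in X]/(iota 0 52) mem_iota => hm.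
  rewrite big_map -mulr_sumr bE' // spE //.
  by case: eqP => //= ->; rewrite mul0r.
rewrite !big_split /= -!(mulE _ _ _ _ bE) // !coE -!big_cat /= -catA -/(jac _ _ _ _) -coE.
set v := jac _ _ _ _.
have [/hasP[p pin /eqP <-]|hn] := boolP (has (fun p => p.1 == l) v); last first.
  by rewrite coE big_hasC.
have chk : let t := tab in
    all (fun i => all (fun j => all (fun k => let v := jac (look t) i j k in
      all (fun p => co p.1 v == 0) v) (iota 0 52)) (iota 0 52)) (iota 0 52).
  by vm_compute.
have /allP H := allP (allP (allP chk _ (inI _ hi)) _ (inI _ hj)) _ (inI _ hk).
apply/eqP; exact: (H _ pin).
Qed.

(** * Root subgroups *)

(* The matrix of ad e_alpha, acting on column vectors. *)
Definition ad_root (F : finFieldType) (a : posroot) : 'M[F]_52 :=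
  \matrix_(k, j) (lie_const (4 + a) j k)%:~R.

Lemma lie_const_wt (i j k : nat) :
  (i < 52)%N -> (j < 52)%N -> lie_const i j k != 0 -> wt k = wt i + wt j.
Proof.
move=> Hi Hj; rewrite /lie_const.
have wt0 n : (n < 4)%N -> wt n = 0 by rewrite /wt => ->.
case: (ltnP i 4) => hi; case: (ltnP j 4) => hj; rewrite ?eqxx //.
- by case: (k =P j) => [-> _|]; rewrite ?eqxx // (wt0 i) // add0r.
- by case: (k =P i) => [-> _|]; rewrite ?eqxx // (wt0 j) // addr0.
have [e0|_] := eqVneq (wt i + wt j) 0.
  by rewrite e0; case: ifP => [/wt0|]; rewrite ?eqxx.
by case: ifP => [/andP[_ /eqP]|]; rewrite ?eqxx.
Qed.

Lemma ad_root_cube (F : finFieldType) (a : posroot) : ad_root F a ^+ 3 = 0.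
Proof.
have no3 (j k : 'I_52) : wt k <> wt (4 + a) *+ 3 + wt j.
  have chk : all (fun r => all (fun s => r *+ 3 + s \notin 0 :: all_roots)
      (0 :: all_roots)) pos_roots by vm_compute.
  have wtin (i : 'I_52) : wt i \in 0 :: all_roots.
    have /allP : all (fun i => wt i \in 0 :: all_roots) (iota 0 52) by vm_compute.
    by apply; rewrite mem_iota ltn_ord.
  have wta : wt (4 + a) \in pos_roots.
    by rewrite /wt /= addKn /all_roots nth_cat /= ltn_ord mem_nth.
  move/allP/(_ _ wta)/allP/(_ _ (wtin j)): chk => /negP H e.
  by apply: H; rewrite -e wtin.
have grad (j k : 'I_52) : ad_root F a k j != 0 -> wt k = wt (4 + a) + wt j.
  rewrite mxE => h; apply: lie_const_wt => //; first by rewrite (ltn_add2l 4 a 48) (leq_trans (ltn_ord a)).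
  by apply: contra h => /eqP->.
apply/matrixP => k j; rewrite !exprS expr0 mulr1 [RHS]mxE [LHS]mxE.
apply: big1 => l _; rewrite [X in _ * X]mxE mulr_sumr big1 // => m _.
apply/eqP; rewrite !mulf_eq0; apply/negPn/negP.
rewrite !negb_or => /and3P[/grad e1 /grad e2 /grad e3].
apply: (no3 j k); rewrite e1 e2 e3 !mulrS mulr0n addr0 !addrA //.
Qed.

(* The exponential of t ad e_alpha; the series stops at i = 2 by ad_root_cube,
   and 2 is invertible in F when the characteristic is odd. *)
Definition exp_ad (F : finFieldType) (a : posroot) (t : F) : 'M[F]_52 :=
  \sum_(i < 3) (t ^+ i / (i`!)%:R) *: ad_root F a ^+ i.

Lemma exp_ad_unit (F : finFieldType) (a : posroot) (t : F) :
  exp_ad a t \is a GRing.unit.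
Proof.
have nil (R : unitAlgType F) (A : R) (x y z : F) :
    x != 0 -> A ^+ 3 = 0 -> x *: 1 + y *: A + z *: A ^+ 2 \is a GRing.unit.
  move=> x0 A3; have [k kE] : exists k, y = x * k by exists (x^-1 * y); rewrite mulVKf.
  have [l lE] : exists l, z = x * l by exists (x^-1 * z); rewrite mulVKf.
  set C := k *: 1 + l *: A; pose B := A * C.
  have AC : GRing.comm A C.
    by rewrite /GRing.comm mulrDr mulrDl -!scalerAl -!scalerAr mulr1 mul1r.
  have B3 : B ^+ 3 = 0 by rewrite exprMn_comm // A3 mul0r.
  rewrite (_ : _ + _ = x *: (1 + B)); last first.
    rewrite /B mulrDr -!scalerAr mulr1 -expr2 !scalerDr !scalerA addrA.
    by rewrite kE lE.
  rewrite scaler_unit ?unitfE //; apply/unitrP; exists (1 - B + B ^+ 2).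
  rewrite !(mulrDl, mulrDr, mulrN, mulNr, mul1r, mulr1) -exprS -exprSr B3 -expr2.
  move: (B ^+ 2) => B2; rewrite !addr0.
  split; first by rewrite addrACA !addrA !subrK.
  by rewrite addrACA subrK subrr addr0.
rewrite /exp_ad; rewrite 3!big_ord_recl big_ord0 addr0 addrA /= expr1; apply: nil.
  by rewrite fact0 divr1 oner_eq0.
exact: ad_root_cube.
Qed.

(* x_alpha(t) in the Chevalley group acting on the Lie algebra over F. *)
Definition xroot (F : finFieldType) (a : posroot) (t : F) : {'GL_52[F]} :=
  FinRing.unit 'M[F]_52 (exp_ad_unit a t).

Definition Xset (F : finFieldType) (a : posroot) : {set {'GL_52[F]}} :=
  [set xroot a t | t : F].

Definition P (F : finFieldType) (S : {set posroot}) : {group {'GL_52[F]}} :=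
  <<\bigcup_(a in S) Xset F a>>%G.

Definition UF4 (F : finFieldType) : {group {'GL_52[F]}} := P F [set: posroot].

Definition Sgrp (F : finFieldType) (a : posroot) : {group {'GL_52[F]}} :=
  P F (source a).

Definition Tker (F : finFieldType) (a : posroot) : {group {'GL_52[F]}} :=
  P F (a |: (if a \in R4normal then leg a else legbar a) :|: kset a).

Definition Tbar (F : finFieldType) (a : posroot) : {group coset_of (Tker F a)} :=
  (Sgrp F a / Tker F a)%G.

(* X_alpha is identified with the quotient of S_alpha by this subgroup. *)
Definition Xker (F : finFieldType) (a : posroot) : {group {'GL_52[F]}} :=
  P F (source a :\ a).

Definition Xbar (F : finFieldType) (a : posroot) : {group coset_of (Xker F a)} :=
  (Sgrp F a / Xker F a)%G.

(** * Characters *)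

Definition Irr (gT : finGroupType) (G : {group gT}) : pred 'CF(G) :=
  [pred chi | chi \in irr G].
Arguments Irr {gT} G chi.

Definition Irr_lin (gT : finGroupType) (G : {group gT}) : pred 'CF(G) :=
  [pred chi | (chi \in irr G) && (chi 1%g == 1)].
Arguments Irr_lin {gT} G chi.

Definition Irr_star (gT : finGroupType) (G : {group gT}) : pred 'CF(G) :=
  [pred chi | (chi \in irr G) && (chi != 1)].
Arguments Irr_star {gT} G chi.

Definition root_support (F : finFieldType) (chi : 'CF(UF4 F)) : {set posroot} :=
  [set g | (Xset F g \subset 'Z(chi)%CF) && ~~ (Xset F g \subset cfker chi)].

Definition Irr_U (F : finFieldType) (a : posroot) : pred 'CF(UF4 F) :=
  [pred chi | (chi \in irr (UF4 F)) && (root_support chi == [set a])].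
Arguments Irr_U F a chi : clear implicits.

Definition Irr_mida (F : finFieldType) (a : posroot) : pred 'CF(UF4 F) :=
  [pred chi | Irr_U F a chi &&
     all (fun psi : 'CF(UF4 F) => Irr_U F a psi ==> (chi 1%g <= psi 1%g)) (irr (UF4 F))].
Arguments Irr_mida F a chi : clear implicits.

Definition Psi (F : finFieldType) (a : posroot) (x : 'CF(Tbar F a) * 'CF(Xbar F a)) :
    'CF(UF4 F) :=
  'Ind[UF4 F] ((x.1 %% Tker F a)%CF * (x.2 %% Xker F a)%CF : 'CF(Sgrp F a)).
Arguments Psi F a x : clear implicits.

Definition one_to_one (A B : Type) (D : pred A) (E : pred B) (f : A -> B) : Prop :=
  [/\ forall x, D x -> E (f x),
      forall x y, D x -> D y -> f x = f y -> x = y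
    & forall z, E z -> exists2 x, D x & f x = z].

(* Entry m - 1 is the pair (c, d) for alpha_m. *)
Definition mida_table : seq (nat * nat) :=
  [:: (0, 0); (0, 0); (0, 0); (0, 0); (0, 1); (0, 1); (0, 1); (1, 2); (1, 1);
      (1, 2); (3, 2); (2, 3); (1, 3); (2, 3); (5, 4); (2, 2); (4, 5); (4, 3);
      (3, 6); (4, 4); (3, 7); (4, 5); (4, 6); (3, 7)]%N.

(* Main.v *)
Require Import Defs.
From mathcomp Require Import all_boot all_order all_algebra all_fingroup all_solvable.
From mathcomp Require Import all_field all_character.
From mathcomp Require Import ring.

Import GroupScope Order.TTheory GRing.Theory Num.Theory.
Local Open Scope ring_scope.

Set Implicit Arguments.
Unset Strict Implicit.
Unset Printing Implicit Defensive.

(** The root elements x_a(t) are additive in t, and the commutator of x_a(s) and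
    x_b(t) is x_(a+b)(C s t), with C nonzero because p is odd, times at most one
    further root element, attached to 2a+b or a+2b ([xroot_comm_sum]).  This is an
    identity between 52 x 52 matrices whose entries are polynomials in s and t
    with integral coefficients, so it can be verified on the 52 basis vectors by
    computation with sparse integral vectors ([xroot_mul_comm]).  Moreover
    x_a(t) lies in the group generated by the later root subgroups only if t = 0,
    as its action on the Cartan part shows ([xroot_free]).  These facts are
    collected in [chevalley_family].  They imply that P(S) has order q^|S| for a
    closed pattern S, that P(N) is normal in P(S) if N is normal in S, and that
    P(S) has an abelianization read off from the sums of two roots of S.

    The characters are reached by removing the roots of the arm one at a time.
    Suppose that P(K) is normal in P(S), that the root z is central modulo K, that
    d + g = z, and that d is central modulo K once g has been removed from S.  An
    irreducible character of P(S) with P(K) in its kernel and X_z not in its kernel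
    vanishes on the elements of X_d outside P(K), because conjugation by X_g
    multiplies them by all of X_z.  Hence its restriction to X_d contains the
    trivial character, and it is induced from a unique character of P(S \ {g}) that
    has P(K) and X_d in its kernel ([arm_leg_step], [pattern_step]).

    A character has root support {a} exactly when k(a) is in its kernel and X_a is
    not ([root_support_singleton]).  Outside alpha_20 and alpha_22 the pairs (arm
    root, leg root) can be removed in the order of the table, so that induction is
    a bijection from the characters of S_a with leg(a) and k(a) in the kernel and
    X_a not in the kernel.  For the two exceptional roots a further root b becomes
    central modulo the kernel on the way.  If X_b is in the kernel the removal
    goes on, which enlarges the leg to its closure; otherwise there are more pairs
    with sum b than arm roots left, and the degree exceeds q^|arm|
    ([covers_alpha20], [covers_alpha22]).

    Modulo P(leg and k(a)), with the closed leg for the exceptional roots, the group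
    S_a is the direct product of T_a and X_a, which gives the pairs (mu, lambda)
    ([central_mul_bijection]).  The degree of the image of (mu, lambda) is
    q^|arm| mu(1), so the minimal degree is q^|arm|, attained for linear mu, and
    there are |T_a : T_a'| = q^c of these. *)

(** * Sparse vectors and the columns of the exponentials *)

Lemma posroot_iota (a : posroot) : (a : nat) \in iota 0 24.
Proof. by rewrite mem_iota ltn_ord. Qed.

Definition lie_col (a j : nat) : seq (nat * int) :=
  [seq p <- [seq (k, lie_const (4 + a) j k) | k <- iota 0 52] | p.2 != 0].

Section Collect.
Variable (I : eqType).
Implicit Types (p : I * int) (v : seq (I * int)).

(** A list of pairs (i, n) stands for the formal sum of the n [i]; adding a pair
    to the list merges it with the pair of the same index, so that [collect]
    normalizes formal sums and a sum is zero once all its coefficients are. *)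
Fixpoint add_entry p v : seq (I * int) :=
  if v is q :: v' then
    if q.1 == p.1 then (q.1, q.2 + p.2) :: v' else q :: add_entry p v'
  else [:: p].

Definition collect v := foldr add_entry [::] v.

Lemma sum_collect (M : zmodType) (f : I -> M) v :
  \sum_(p <- collect v) f p.1 *~ p.2 = \sum_(p <- v) f p.1 *~ p.2.
Proof.
elim: v => [|p v IHv]; first by rewrite !big_nil.
rewrite big_cons -IHv /=.
elim: (collect v) => [|q w IHw] /=; first by rewrite big_cons.
case: eqP => [e|_]; rewrite !big_cons /= ?mulrzDr.
  by rewrite e [RHS]addrCA addrA.
by rewrite IHw addrCA.
Qed.

Definition opp_entries v := [seq (p.1, - p.2) | p <- v].

Lemma sum_collect_eq (M : zmodType) (f : I -> M) v w :
  all (fun p => p.2 == 0) (collect (v ++ opp_entries w)) ->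
  \sum_(p <- v) f p.1 *~ p.2 = \sum_(p <- w) f p.1 *~ p.2.
Proof.
move=> /allP z; apply/eqP; rewrite -subr_eq0; apply/eqP.
have: \sum_(p <- collect (v ++ opp_entries w)) f p.1 *~ p.2 = 0.
  by rewrite big_seq big1 // => p /z/eqP->; rewrite mulr0z.
rewrite sum_collect big_cat big_map /= -sumrN => e.
by rewrite -[RHS]e; congr (_ + _); apply: eq_bigr => p _; rewrite mulrNz.
Qed.
End Collect.

Definition sq_col (lr : nat -> seq (nat * int)) (j : nat) : seq (nat * int) :=
  collect (flatten [seq [seq (q.1, p.2 * q.2) | q <- lr p.1] | p <- lr j]).

(** The triple (k, n, c) is the term c u^n e_k of the image of e_j under
    exp(u ad e_a).  The entries of (ad e_a)^2 are even ([sq_col_check]), so the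
    coefficients are integers. *)
Definition exp_col (a j : nat) : seq (nat * nat * int) :=
  (j, 0%N, 1) :: [seq (p.1, 1%N, p.2) | p <- lie_col a j]
  ++ [seq (p.1, 2%N, (p.2 %/ 2)%Z) | p <- sq_col (lie_col a) j].

Section Columns.
Variable F : finFieldType.
Implicit Types (a : posroot) (s t u : F).

Notation e j := (delta_mx (inord j : 'I_52) 0 : 'cV[F]_52).

Lemma ad_root_col a (j : nat) : (j < 52)%N ->
  ad_root F a *m e j = \sum_(p <- lie_col a j) e p.1 *~ p.2.
Proof.
move=> hj; rewrite -colE; apply/matrixP => k l; rewrite !mxE inordK // summxE.
rewrite big_filter big_map big_mkcond -[iota 0 52]/(index_iota 0 52) big_mkord.
rewrite (bigD1 k) //= big1 => [|i ik]; rewrite ?addr0.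
  case: eqP => /= [->|_] //; rewrite -scaler_int !mxE inord_val.
  by rewrite (ord1 l) !eqxx mulr1.
by case: ifP => // _; rewrite -scaler_int !mxE inord_val eq_sym (negPf ik) /= mulr0.
Qed.

Lemma exp_adE a u :
  exp_ad a u = 1 + (u *: ad_root F a + (u ^+ 2 / 2%:R) *: ad_root F a ^+ 2).
Proof.
rewrite /exp_ad 3!big_ord_recl big_ord0 addr0 /=.
by rewrite expr0 expr1 fact0 divr1 scale1r /bump /= add1n expr1 divr1.
Qed.

Hypothesis two_neq0 : 2%:R != 0 :> F.

Lemma lie_col_lt (a j : nat) p : p \in lie_col a j -> (p.1 < 52)%N.
Proof.
by rewrite mem_filter => /andP[_ /mapP[k]]; rewrite mem_iota => /andP[_ hk] ->.
Qed.

Lemma sq_col_check : all (fun a : nat => all (fun j =>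
    all (fun p => (p.1 < 52)%N && (p.2 == (p.2 %/ 2)%Z * 2)) (sq_col (lie_col a) j))
  (iota 0 52)) (iota 0 24).
Proof. by vm_compute. Qed.

Lemma sq_colP (a j : nat) p : (a < 24)%N -> (j < 52)%N -> p \in sq_col (lie_col a) j ->
  (p.1 < 52)%N /\ p.2 = (p.2 %/ 2)%Z * 2.
Proof.
move=> ha hj hp; have := allP sq_col_check a; rewrite mem_iota => /(_ ha).
by move=> /allP/(_ j); rewrite mem_iota => /(_ hj)/allP/(_ p hp)/andP[? /eqP].
Qed.

Lemma exp_ad_col a (u : F) (j : nat) : (j < 52)%N ->
  exp_ad a u *m e j = \sum_(q <- exp_col a j) (u ^+ q.1.2 *: e q.1.1) *~ q.2.
Proof.
move=> hj; rewrite exp_adE big_cons big_cat !big_map /= expr0 scale1r mulr1z.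
rewrite !mulmxDl mul1mx -!scalemxAl ad_root_col //.
congr (_ + (_ + _)).
  by rewrite scaler_sumr; apply: eq_bigr => p _; rewrite expr1 scalerMzr.
rewrite expr2 -mulmxA ad_root_col // mulmx_sumr.
have -> : \sum_(p <- lie_col a j) ad_root F a *m (e p.1 *~ p.2)
    = \sum_(p <- sq_col (lie_col a) j) e p.1 *~ p.2.
  rewrite /sq_col (sum_collect (fun k => e k)) big_flatten big_map.
  rewrite big_seq [RHS]big_seq; apply: eq_bigr => p /lie_col_lt hp.
  rewrite -scaler_int -scalemxAr ad_root_col // big_map scaler_sumr.
  by apply: eq_bigr => q _; rewrite scaler_int -mulrzA mulrC.
rewrite scaler_sumr big_seq [RHS]big_seq; apply: eq_bigr => p hp.
have [_ {1}->] := sq_colP (ltn_ord a) hj hp.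
rewrite mulrC mulrzA -scaler_int scalerMzr scalerA.
by rewrite mulrAC mulVf // mul1r.
Qed.

(** The index (k, i, j) of a sparse vector with polynomial entries is the
    monomial s^i t^j at the basis vector e_k. *)
Definition monom (s t : F) (m : nat * nat * nat) : 'cV[F]_52 :=
  (s ^+ m.1.2 * t ^+ m.2) *: e m.1.1.
End Columns.

(** The action on such vectors of exp(u ad e_a) with u = C s^i t^j for
    m = (C, i, j).  The columns are a parameter so that they can be tabulated once
    for the whole verification. *)
Definition act_exp (tab : nat -> nat -> seq (nat * nat * int)) (a : nat)
    (m : int * nat * nat) (v : seq (nat * nat * nat * int)) :=
  flatten [seq [seq ((q.1.1, p.1.1.2 + q.1.2 * m.1.2, p.1.2 + q.1.2 * m.2)%N,
                     p.2 * (q.2 * m.1.1 ^+ q.1.2))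
                  | q <- tab a p.1.1.1] | p <- v].

Lemma exp_col_lt (a j : nat) q : (a < 24)%N -> (j < 52)%N ->
  q \in exp_col a j -> (q.1.1 < 52)%N.
Proof.
move=> ha hj; rewrite inE mem_cat => /or3P[/eqP-> //|/mapP[p /lie_col_lt hp ->] //|].
by case/mapP => p /(sq_colP ha hj)[hp _] ->.
Qed.

Section Act.
Variables (F : finFieldType).
Hypothesis two_neq0 : 2%:R != 0 :> F.
Implicit Types (a : posroot) (s t u : F).

Lemma act_exp_lt (a : nat) m v : (a < 24)%N -> all (fun p => (p.1.1.1 < 52)%N) v ->
  all (fun p => (p.1.1.1 < 52)%N) (act_exp exp_col a m v).
Proof.
move=> ha /allP hv; apply/allP => p /flattenP[w /mapP[r rv ->] /mapP[q hq ->]] /=.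
exact: exp_col_lt ha (hv _ rv) hq.
Qed.

Lemma act_expE a m v s t : all (fun p => (p.1.1.1 < 52)%N) v ->
  exp_ad a (m.1.1%:~R * s ^+ m.1.2 * t ^+ m.2) *m
    (\sum_(p <- v) monom s t p.1 *~ p.2)
  = \sum_(p <- act_exp exp_col a m v) monom s t p.1 *~ p.2.
Proof.
move=> /allP hv; rewrite mulmx_sumr big_flatten big_map big_seq [RHS]big_seq.
apply: eq_bigr => p /hv hp; rewrite /monom -scaler_int -!scalemxAr exp_ad_col //.
rewrite scalerA scaler_sumr big_map; apply: eq_bigr => q _ /=.
rewrite -2!scaler_int !scalerA; congr (_ *: _).
rewrite !rmorphM /= rmorphXn /= ![(q.1.2 * _)%N]mulnC !exprD !exprMn !exprM.
ring.
Qed.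
End Act.

(** The factors x_c(C s^i t^j) of the commutator of x_a(s) and x_b(t), written
    (c, (C, i, j)).  With A = s ad e_a and B = t ad e_b, the conjugate of exp A by
    exp B is exp(A + [A, B] + [B, [B, A]] / 2), and multiplying it by exp(-A) adds
    - [A, [A, B]] / 2 to the exponent; this explains the signs. *)
Definition comm_terms (a b : nat) : seq (nat * (int * nat * nat)) :=
  let r := nth 0 pos_roots a in let s := nth 0 pos_roots b in
  [seq p <- [:: (index (r + s) pos_roots, (Nconst r s, 1%N, 1%N));
      (index (r + r + s) pos_roots,
        (- (Nconst r s * Nconst r (r + s) %/ 2)%Z, 2%N, 1%N));
      (index (r + s + s) pos_roots,
        ((Nconst s r * Nconst s (r + s) %/ 2)%Z, 1%N, 2%N))]
     | (p.1 < 24)%N].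

(** The comparison is formal in s and t, hence independent of the field. *)
Definition commutes_on tab (cs : seq (nat * (int * nat * nat))) (a b j : nat) : bool :=
  let act := act_exp tab in
  let v0 := [:: ((j, 0%N, 0%N), 1)] in
  let v := act a (1, 1%N, 0%N) (act b (1, 0%N, 1%N) v0) in
  let w := act b (1, 0%N, 1%N) (act a (1, 1%N, 0%N)
             (foldr (fun p => act p.1 p.2) v0 cs)) in
  all (fun p => p.2 == 0) (collect (v ++ opp_entries w)).

Lemma comm_check :
  let tab := mkseq (fun a => mkseq (exp_col a) 52) 24 in
  all (fun a => all (fun b => (a != b) ==> let cs := comm_terms a b in
    all (commutes_on (fun i j => nth [::] (nth [::] tab i) j) cs a b) (iota 0 52))
  (iota 0 24)) (iota 0 24).
Proof. by vm_compute. Qed.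

(** * The commutator formula *)

Section RootElements.
Variables (F : finFieldType).
Hypothesis two_neq0 : 2%:R != 0 :> F.
Implicit Types (a b c : posroot) (s t u : F).

Lemma xrootD a s t : xroot a (s + t) = (xroot a s * xroot a t)%g.
Proof.
apply: val_inj => /=; rewrite !exp_adE.
have A3 := ad_root_cube F a; move: (ad_root F a) A3 => A A3.
have A4 : A ^+ 2 * A ^+ 2 = 0 by rewrite -exprD (exprD _ 3 1) A3 mul0r.
have A12 : A * A ^+ 2 = 0 by rewrite -exprS.
have A21 : A ^+ 2 * A = 0 by rewrite -exprSr.
rewrite !(mulrDl, mulrDr) !mul1r !mulr1 -!scalerAl -!scalerAr A12 A21 A4 !scaler0.
rewrite -[A * A]expr2 !addr0 -!addrA; congr (_ + _).
rewrite !scalerA scalerDl -!addrA.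
rewrite (addrCA ((t ^+ 2 / 2) *: A ^+ 2)) [RHS]addrCA; congr (_ + _).
congr (_ + _); rewrite -!scalerDl; congr (_ *: _).
apply: (mulIf two_neq0); rewrite !mulrDl !divfK //; ring.
Qed.

Lemma mx_col_ext (A B : 'M[F]_52) :
  (forall j, (j < 52)%N ->
     A *m delta_mx (inord j : 'I_52) (0 : 'I_1) = B *m delta_mx (inord j) 0) ->
  A = B.
Proof.
move=> eqAB; apply/matrixP => i j; have := eqAB j (ltn_ord j); rewrite inord_val.
by rewrite -!colE => /matrixP/(_ i 0); rewrite !mxE.
Qed.

Lemma comm_terms_lt a b p : p \in comm_terms a b -> (p.1 < 24)%N.
Proof. by rewrite mem_filter => /andP[]. Qed.

(** It suffices to compare the columns of both sides, and these are evaluations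
    of polynomial vectors whose coefficients agree by [comm_check]. *)
Lemma xroot_mul_comm a b s t : a != b ->
  (xroot a s * xroot b t = xroot b t * xroot a s * \prod_(p <- comm_terms a b)
     xroot (inord p.1) (p.2.1.1%:~R * s ^+ p.2.1.2 * t ^+ p.2.2)%R)%g.
Proof.
move=> ab; apply: val_inj => /=; apply: mx_col_ext => j hj.
pose v0 := [:: ((j, 0%N, 0%N), 1 : int)].
have hv0 : all (fun p => (p.1.1.1 < 52)%N) v0 by rewrite /= hj.
have v0E : delta_mx (inord j : 'I_52) 0 = \sum_(p <- v0) monom s t p.1 *~ p.2.
  by rewrite big_seq1 /monom /= !expr0 mulr1 scale1r mulr1z.
pose act := act_exp exp_col.
have actE c m (v : seq (nat * nat * nat * int)) : all (fun p => (p.1.1.1 < 52)%N) v ->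
  (exp_ad c (m.1.1%:~R * s ^+ m.1.2 * t ^+ m.2) : 'M_52) *m
    (\sum_(p <- v) monom s t p.1 *~ p.2)
  = \sum_(p <- act c m v) monom s t p.1 *~ p.2 := act_expE two_neq0 c m s t.
have aE c (v : seq (nat * nat * nat * int)) : all (fun p => (p.1.1.1 < 52)%N) v ->
  (exp_ad c s : 'M_52) *m (\sum_(p <- v) monom s t p.1 *~ p.2)
  = \sum_(p <- act c (1, 1%N, 0%N) v) monom s t p.1 *~ p.2.
  by move=> hv; rewrite -actE //= expr1 expr0 mulr1 mul1r.
have bE c (v : seq (nat * nat * nat * int)) : all (fun p => (p.1.1.1 < 52)%N) v ->
  (exp_ad c t : 'M_52) *m (\sum_(p <- v) monom s t p.1 *~ p.2)
  = \sum_(p <- act c (1, 0%N, 1%N) v) monom s t p.1 *~ p.2.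
  by move=> hv; rewrite -actE //= expr1 expr0 mulr1 mul1r.
have lt (c : nat) m (v : seq (nat * nat * nat * int)) : (c < 24)%N ->
  all (fun p => (p.1.1.1 < 52)%N) v ->
  all (fun p => (p.1.1.1 < 52)%N) (act c m v) := @act_exp_lt c m v.
have actd : act = act_exp exp_col by [].
clearbody act.
pose tab := fun i k => nth [::] (nth [::] (mkseq (fun c : nat => mkseq (exp_col c) 52) 24) i) k.
have tabE (c : nat) m v : (c < 24)%N -> all (fun p => (p.1.1.1 < 52)%N) v ->
    act_exp tab c m v = act c m v.
  move=> hc /allP hv; rewrite actd /act_exp; congr flatten; apply/eq_in_map => p /hv hp.
  by rewrite /tab nth_mkseq // nth_mkseq.
(* the product of the factors acts as the iterated sparse action, which stays in
   range and can be read off from the table *)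
have [prodE prod_lt prod_tab] : let v := foldr (fun p => act p.1 p.2) v0 (comm_terms a b) in
    [/\ val (\prod_(p <- comm_terms a b)
          xroot (inord p.1) (p.2.1.1%:~R * s ^+ p.2.1.2 * t ^+ p.2.2)%R)%g *m delta_mx (inord j) 0
        = \sum_(p <- v) monom s t p.1 *~ p.2,
        all (fun p => (p.1.1.1 < 52)%N) v
      & foldr (fun p => act_exp tab p.1 p.2) v0 (comm_terms a b) = v].
  have := @comm_terms_lt a b; elim: (comm_terms a b) => [|p w IHw] hw.
    by split=> //; rewrite big_nil mul1mx v0E.
  have hp := hw p (mem_head _ _).
  have [|e l] := IHw; first by move=> q hq; apply: hw; rewrite inE hq orbT.
  have foldE f : foldr f v0 (p :: w) = f p (foldr f v0 w) by [].
  move=> tabw v; rewrite {}/v !foldE tabw (tabE _ _ _ hp l).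
  move: (foldr _ _ w) e l => v e l.
  rewrite big_cons /= -mulmxA e actE // inordK //.
  by rewrite lt.
have [ha hb] := (ltn_ord a, ltn_ord b).
rewrite -!mulmxA prodE v0E (bE _ _ hv0) (aE _ _ (lt _ _ _ hb hv0)).
rewrite (aE _ _ prod_lt) (bE _ _ (lt _ _ _ ha prod_lt)).
apply: (sum_collect_eq (monom s t)).
have := allP (allP comm_check _ (posroot_iota a)) _ (posroot_iota b); rewrite ab.
move=> /allP/(_ j); rewrite mem_iota => /(_ hj).
rewrite /commutes_on -/v0 -/tab prod_tab.
by rewrite (tabE _ _ _ _ hv0) // (tabE _ _ _ _ prod_lt) // !tabE // lt.
Qed.
End RootElements.

(** A root of F4 has a string of length at most 3, so beside a + b at most one
    of 2a + b and a + 2b is a root; the structure constants are +-1 or +-2, hence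
    nonzero in odd characteristic. *)
Lemma comm_terms_check :
  all (fun a => all (fun b => (a != b) ==>
    let r := nth 0 pos_roots a in let s := nth 0 pos_roots b in
    match comm_terms a b with
    | [::] => r + s \notin pos_roots
    | (c, (C, i, j)) :: w =>
      [&& (c < 24)%N, nth 0 pos_roots c == r + s, absz C \in [:: 1; 2]%N, (i, j) == (1, 1)%N &
        match w with
        | [::] => true
        | [:: (d, (D, i, j))] =>
          [&& (d < 24)%N, absz D \in [:: 1; 2]%N &
           (((i, j) == (2, 1)%N) && (nth 0 pos_roots d == nth 0 pos_roots c + r)) ||
           (((i, j) == (1, 2)%N) && (nth 0 pos_roots d == nth 0 pos_roots c + s))]
        | _ => false
        end]
    end) (iota 0 24)) (iota 0 24).
Proof. by vm_compute. Qed.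

Lemma coef_inj : injective coef.
Proof.
move=> a b /eqP; rewrite /coef nth_uniq ?ltn_ord // => /eqP e; exact: val_inj.
Qed.

Lemma coef_double_nroot a c : ~~ is_sum a a c.
Proof.
have chk : all (fun a => nth 0 pos_roots a + nth 0 pos_roots a \notin pos_roots) (iota 0 24).
  by vm_compute.
have := allP chk a; rewrite mem_iota ltn_ord => /(_ isT); apply: contra => /eqP <-.
by rewrite mem_nth.
Qed.

Lemma is_sumC a b c : is_sum a b c = is_sum b a c.
Proof. by rewrite /is_sum addrC. Qed.

Section Commutators.
Variables (F : finFieldType).
Hypothesis two_neq0 : 2%:R != 0 :> F.
Implicit Types (a b c d : posroot) (s t u : F).

Lemma small_int_neq0 (C : int) : absz C \in [:: 1; 2]%N -> C%:~R != 0 :> F.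
Proof.
have e (n : nat) : n \in [:: 1; 2]%N -> n%:R != 0 :> F.
  by rewrite !inE => /orP[] /eqP->; rewrite ?oner_eq0.
case: C => n /e //; rewrite NegzE rmorphN oppr_eq0 //.
Qed.

Lemma xroot_commE a b s t : a != b -> [~ xroot a s, xroot b t]%g =
  (\prod_(p <- comm_terms a b)
    xroot (inord p.1) (p.2.1.1%:~R * s ^+ p.2.1.2 * t ^+ p.2.2)%R)%g.
Proof.
move=> ab; rewrite commgEl conjgE /= -[RHS](mulKg (xroot b t * xroot a s)%g).
by rewrite -(xroot_mul_comm two_neq0 s t ab) invMg !mulgA.
Qed.

Lemma xroot_comm0 a b s t : (forall c, ~~ is_sum a b c) ->
  [~ xroot a s, xroot b t]%g = 1%g.
Proof.
have [-> _|ab nsum] := eqVneq a b.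
  by apply/eqP/commgP; rewrite /commute -!xrootD // addrC.
rewrite xroot_commE //; have := allP (allP comm_terms_check _ (posroot_iota a)) _ (posroot_iota b).
rewrite (ab : (a : nat) != b) /=; case: comm_terms => [|[c [[C i] j]] w].
  by rewrite big_nil.
case/and5P=> hc /eqP e _ _ _; case/negP: (nsum (Ordinal hc)).
by rewrite /is_sum /coef /= e.
Qed.

(** The second factor is attached to c + a = 2a + b or to c + b = a + 2b. *)
Lemma xroot_comm_sum a b c : is_sum a b c -> exists2 C : F, C != 0 &
  [\/ forall s t, [~ xroot a s, xroot b t]%g = xroot c (C * s * t),
      exists d (D : F), [/\ D != 0, is_sum c a d &
        forall s t, [~ xroot a s, xroot b t]%g
           = (xroot c (C * s * t)%R * xroot d (D * s ^+ 2 * t)%R)%g]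
    | exists d (D : F), [/\ D != 0, is_sum c b d &
        forall s t, [~ xroot a s, xroot b t]%g
           = (xroot c (C * s * t)%R * xroot d (D * s * t ^+ 2)%R)%g] ].
Proof.
move=> abc; have ab : a != b.
  by apply: contraL abc => /eqP->; apply: coef_double_nroot.
have := allP (allP comm_terms_check _ (posroot_iota a)) _ (posroot_iota b).
rewrite (ab : (a : nat) != b) /=.
have := fun s t => xroot_commE s t ab.
case: comm_terms => [_|[c' [[C i] j]] w E].
  by rewrite -(eqP abc) mem_nth.
case/and5P=> hc /eqP e C0 /eqP[? ?] hw; subst i j.
have {e} ec : inord c' = c by apply: coef_inj; rewrite (eqP abc) /coef inordK.
exists C%:~R; first exact: small_int_neq0.
case: w hw E => [|[d [[D i'] j']] [|//]] hw E.
  by apply: Or31 => s t; rewrite E big_seq1 /= ec !expr1.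
case/and3P: hw => hd D0 /orP[]/andP[/eqP[? ?] /eqP e]; subst i' j'.
  apply: Or32; exists (Ordinal hd), D%:~R; split; first exact: small_int_neq0.
    by rewrite /is_sum [coef (Ordinal hd)]e -ec /coef inordK.
  by move=> s t; rewrite E !big_cons big_nil mulg1 /= ec !expr1 -(inord_val (Ordinal hd)).
apply: Or33; exists (Ordinal hd), D%:~R; split; first exact: small_int_neq0.
  by rewrite /is_sum [coef (Ordinal hd)]e -ec /coef inordK.
by move=> s t; rewrite E !big_cons big_nil mulg1 /= ec !expr1 -(inord_val (Ordinal hd)).
Qed.
End Commutators.

(** * Abstract root subgroups and pattern groups *)

Section Family.
Local Open Scope group_scope.
Variables (F : finFieldType) (gT : finGroupType) (x : posroot -> F -> gT).

Definition root_group (a : posroot) : {set gT} := [set x a t | t : F].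

Definition pattern_group (S : {set posroot}) : {group gT} :=
  <<\bigcup_(a in S) root_group a>>%G.

(** What the character theory needs to know about the root elements.  Keeping
    the group abstract hides the 52 x 52 matrices from the later arguments.  The
    last field makes expressions as ordered products of root elements unique. *)
Record chevalley_family : Prop := ChevalleyFamily {
  family_two : (2%:R != 0 :> F)%R;
  familyD : forall a s t, x a (s + t)%R = x a s * x a t;
  family_comm0 : forall a b s t, (forall c, ~~ is_sum a b c) -> [~ x a s, x b t] = 1;
  family_comm_sum : forall a b c, is_sum a b c -> exists2 C : F, (C != 0)%R &
    [\/ forall s t, [~ x a s, x b t] = x c (C * s * t)%R,
        exists d (D : F), [/\ (D != 0)%R, is_sum c a d &
          forall s t, [~ x a s, x b t] = x c (C * s * t)%R * x d (D * s ^+ 2 * t)%R]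
      | exists d (D : F), [/\ (D != 0)%R, is_sum c b d &
          forall s t, [~ x a s, x b t] = x c (C * s * t)%R * x d (D * s * t ^+ 2)%R] ];
  family_free : forall a t,
    x a t \in pattern_group [set b : posroot | (a < b)%N] -> t = 0%R }.
End Family.

Section PatternGroups.
Local Open Scope group_scope.
Variables (F : finFieldType) (gT : finGroupType) (x : posroot -> F -> gT).
Hypothesis xF : chevalley_family x.
Local Notation X := (root_group x).
Local Notation P := (pattern_group x).
Implicit Types (a b c d : posroot) (s t u : F) (A B S T N K : {set posroot}).

Lemma mem_root_group a t : x a t \in X a. Proof. exact: imset_f. Qed.

Lemma family0 a : x a 0%R = 1.
Proof. by apply: (mulgI (x a 0%R)); rewrite -(familyD xF) GRing.addr0 mulg1. Qed.

Lemma familyN a s : x a (- s)%R = (x a s)^-1.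
Proof. by apply: (mulgI (x a s)); rewrite mulgV -(familyD xF) GRing.subrr family0. Qed.

Lemma sub_P a S : a \in S -> X a \subset P S.
Proof. by move=> aS; apply: subset_trans (subset_gen _); apply: (bigcup_sup a). Qed.

Lemma mem_P a S t : a \in S -> x a t \in P S.
Proof. by move=> /sub_P/subsetP; apply; apply: mem_root_group. Qed.

Lemma P_subset S (G : {group gT}) :
  (forall a t, a \in S -> x a t \in G) -> P S \subset G.
Proof.
move=> h; rewrite gen_subG; apply/bigcupsP => a aS.
by apply/subsetP => _ /imsetP[t _ ->]; apply: h.
Qed.

Lemma P_mono S T : S \subset T -> P S \subset P T.
Proof. by move=> /subsetP ST; apply: P_subset => a t /ST; apply: mem_P. Qed.

Lemma P_setU S T : P (S :|: T) = (P S <*> P T)%G.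
Proof.
apply/eqP; rewrite -val_eqE eqEsubset /=; apply/andP; split.
  apply: P_subset => a t; rewrite inE => /orP[] h; apply: mem_gen; rewrite inE.
    by rewrite (mem_P _ h).
  by rewrite (mem_P _ h) orbT.
by rewrite join_subG !P_mono ?subsetUl ?subsetUr.
Qed.

Lemma root_group_set a : group_set (X a).
Proof.
apply/group_setP; split; first by rewrite -(family0 a) mem_root_group.
move=> _ _ /imsetP[s _ ->] /imsetP[t _ ->].
by rewrite -(familyD xF) mem_root_group.
Qed.

Lemma P_set1 a : P [set a] = X a :> {set _}.
Proof.
apply/eqP; rewrite eqEsubset sub_P ?set11 // andbT.
by apply: (@P_subset _ (group (root_group_set a))) => b t /set1P->; apply: mem_root_group.
Qed.

Lemma root_group_abelian a : abelian (P [set a]).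
Proof.
apply/centsP => u uX v vX; move: uX vX; rewrite P_set1.
by move=> /imsetP[s _ ->] /imsetP[t _ ->]; rewrite /commute -!(familyD xF) GRing.addrC.
Qed.

Lemma pattern_normalP N S : reflect (N \subset S /\
    forall a b c, a \in N -> b \in S -> is_sum a b c -> c \in N) (pattern_normal N S).
Proof.
apply: (iffP andP) => [[NS /forall_inP h]|[NS h]]; split=> //.
  by move=> a b c /h/forall_inP/[apply]/forallP/(_ c)/implyP.
apply/forall_inP => a aN; apply/forall_inP => b bS; apply/forallP => c.
by apply/implyP; apply: h bS.
Qed.

Lemma closed_normal S : closed_pattern S = pattern_normal S S.
Proof. by rewrite /pattern_normal subxx. Qed.

(** Both possible factors of the commutator lie in P(N): the one at c = a + b by
    assumption, the one at c + a or c + b since N is normal in S. *)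
Lemma comm_mem N S a b s t : pattern_normal N S -> a \in S -> b \in S ->
  (forall c, is_sum a b c -> c \in N) -> [~ x a s, x b t] \in P N.
Proof.
move=> /pattern_normalP[/subsetP NS nNS] aS bS abN.
have [c abc|nsum] := pickP (is_sum a b); last first.
  by rewrite (family_comm0 xF) // => c; rewrite nsum.
have cN := abN c abc.
have [C C0 [->|[d [D [D0 cad] ->]]|[d [D [D0 cbd] ->]]]] := family_comm_sum xF abc.
- exact: mem_P.
- by apply: groupM; apply: mem_P => //; apply: nNS cad.
- by apply: groupM; apply: mem_P => //; apply: nNS cbd.
Qed.

Lemma P_normal N S : pattern_normal N S -> P N <| P S.
Proof.
move=> nNS; have [NS h] := pattern_normalP _ _ nNS.
rewrite /normal P_mono //= gen_subG; apply/bigcupsP => b bS.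
apply/subsetP => _ /imsetP[t _ ->]; rewrite inE sub_conjg gen_subG.
apply/bigcupsP => a aN; apply/subsetP => _ /imsetP[s _ ->].
rewrite mem_conjgV conjg_mulR; apply: groupM; first exact: mem_P.
by apply: (comm_mem _ _ nNS) => // [|c]; [apply: (subsetP NS) | apply: h].
Qed.

(** Modulo P(K) the generators of P(A) centralize those of P(B). *)
Lemma P_comm_sub A B K S : pattern_normal K S -> A \subset S -> B \subset S ->
  (forall a b c, a \in A -> b \in B -> is_sum a b c -> c \in K) ->
  [~: P A, P B] \subset P K.
Proof.
move=> nKS AS BS h; have nK := normal_norm (P_normal nKS).
have [nA nB] := (subset_trans (P_mono AS) nK, subset_trans (P_mono BS) nK).
have sA T : T \subset S -> \bigcup_(a in T) X a \subset 'N(P K).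
  by move=> TS; apply: subset_trans (subset_gen _) (subset_trans (P_mono TS) nK).
rewrite -quotient_cents2 // (quotient_gen (sA _ AS)) (quotient_gen (sA _ BS)) gen_subG /= cent_gen.
rewrite quotient_cents2 ?sA // gen_subG; apply/subsetP.
move=> _ /imset2P[_ _ /bigcupP[a aA /imsetP[s _ ->]] /bigcupP[b bB /imsetP[t _ ->]] ->].
apply: (comm_mem _ _ nKS) => [||c]; [exact: (subsetP AS)|exact: (subsetP BS)|].
exact: h.
Qed.

(** The commutator is x_c(C s t) times a root element whose parameter has degree 3
    in (s, t).  Changing the sign of both s and t fixes the first factor and
    inverts the second one, so a quotient of two commutators isolates the square of
    the second factor, and 2 is invertible. *)
Lemma comm_root_sub (M : {group gT}) a b c : is_sum a b c ->
  (forall s t, [~ x a s, x b t] \in M) -> X c \subset M.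
Proof.
move=> abc hM; have [C C0 h] := family_comm_sum xF abc.
have two v : (v / 2%:R + v / 2%:R = v :> F)%R.
  by rewrite -mulrDl -mulr2n -(mulr_natr v 2) mulfK // (family_two xF).
apply/subsetP => _ /imsetP[u _ ->]; case: h => [E|[d [D [D0 _ E]]]|[d [D [D0 _ E]]]].
- by have := hM 1%R (u / C)%R; rewrite E mulr1 mulrC divfK.
- (* (s, t) = (1, v / 2D) and its opposite *)
  have dM v : x d v \in M.
    have := groupM (groupVr (hM (- 1)%R (- (v / 2%:R / D))%R)) (hM 1%R (v / 2%:R / D)%R).
    rewrite !E !(sqrrN, mulrN, mulNr, expr1n, mulr1, opprK).
    rewrite familyN invMg invgK mulgA mulgKV -(familyD xF).
    by rewrite [(D * _)%R]mulrC divfK // two.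
  by have := hM 1%R (u / C)%R; rewrite E mulr1 [(C * _)%R]mulrC divfK // groupMr.
- have dM v : x d v \in M.
    have := groupM (groupVr (hM (- (v / 2%:R / D))%R (- 1)%R)) (hM (v / 2%:R / D)%R 1%R).
    rewrite !E !(sqrrN, mulrN, mulNr, expr1n, mulr1, opprK).
    rewrite familyN invMg invgK mulgA mulgKV -(familyD xF).
    by rewrite [(D * _)%R]mulrC divfK // two.
  by have := hM (u / C)%R 1%R; rewrite E !mulr1 [(C * _)%R]mulrC divfK // groupMr.
Qed.
End PatternGroups.

(** * Orders and abelianizations of pattern groups *)

(** The numbering of the roots is compatible with their height. *)
Lemma is_sum_lt a b c : is_sum a b c -> (a < c)%N && (b < c)%N.
Proof.
have chk : all (fun i => all (fun j =>
    (i < index (nth 0%R pos_roots i + nth 0%R pos_roots j)%R pos_roots)%N)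
  (iota 0 24)) (iota 0 24) by vm_compute.
have lt (d e : posroot) : is_sum d e c -> (d < c)%N.
  move=> /eqP dec; have := allP (allP chk _ (posroot_iota d)) _ (posroot_iota e).
  by rewrite -[(_ + _)%R]dec /coef index_uniq.
by move=> h; rewrite (lt _ _ h); rewrite is_sumC in h; apply: lt h.
Qed.

Definition root_sums (S : {set posroot}) : {set posroot} :=
  [set c | [exists a in S, exists b in S, is_sum a b c]].

Lemma root_sumsP (S : {set posroot}) c :
  reflect (exists a b, [/\ a \in S, b \in S & is_sum a b c]) (c \in root_sums S).
Proof.
rewrite inE; apply: (iffP exists_inP) => [[a aS /exists_inP[b bS h]]|[a [b [aS bS h]]]].
  by exists a, b.
by exists a => //; apply/exists_inP; exists b.
Qed.

Section PatternOrders.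
Local Open Scope group_scope.
Variables (F : finFieldType) (gT : finGroupType) (x : posroot -> F -> gT).
Hypothesis xF : chevalley_family x.
Local Notation X := (root_group x).
Local Notation P := (pattern_group x).
Implicit Types (a b c d : posroot) (A B S T N K Q : {set posroot}).

Lemma card_root_group a : #|P [set a]| = #|F|.
Proof.
rewrite P_set1 // card_imset // => s t e; apply/eqP; rewrite -GRing.subr_eq0.
apply/eqP; apply: (family_free xF (a := a)).
by rewrite (familyD xF) (familyN xF) e mulgV group1.
Qed.

Lemma P_setD1 S a : a \in S -> pattern_normal (S :\ a) S ->
  P S = P (S :\ a) * P [set a] :> {set gT}.
Proof.
move=> aS nS; have n := normal_norm (P_normal xF nS).
rewrite -{1}(setD1K aS) setUC P_setU /= norm_joinEr //.
by apply: subset_trans n; apply: P_mono; rewrite sub1set.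
Qed.

(** Split off the smallest root of S: it is not a sum of roots of S, so the rest is
    normal in S, and its root subgroup meets P of the rest trivially because the
    rest consists of later roots. *)
Lemma card_P S : closed_pattern S -> #|P S| = (#|F| ^ #|S|)%N.
Proof.
elim: {S}#|S| {-2}S (erefl #|S|) => [|n IHn] S cS clS.
  rewrite (cards0_eq cS) /=.
  by rewrite big_set0 gen0 cards1 cards0.
have [a aS amin] : exists2 a, a \in S & forall b, b \in S -> (a <= b)%N.
  have [a aS] : exists a, a \in S by apply/card_gt0P; rewrite cS.
  by exists [arg min_(i < a in S) i]; case: arg_minnP.
have := clS; rewrite closed_normal => /pattern_normalP[_ cl].
have nS : pattern_normal (S :\ a) S.
  apply/pattern_normalP; split=> [|b c d]; first exact: subD1set.
  rewrite !inE => /andP[_ bS] cS' bcd; rewrite (cl b c) // andbT.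
  apply: contraTneq (amin b bS) => da; rewrite -ltnNge -da.
  by case/andP: (is_sum_lt bcd).
have clS' : closed_pattern (S :\ a).
  rewrite closed_normal; apply/pattern_normalP; split=> // b c d b1 c1.
  by have [_ h] := pattern_normalP _ _ nS; apply: h b1 _; apply: subsetP c1; apply: subD1set.
have cS1 : #|S :\ a| = n by move: cS; rewrite (cardsD1 a) aS => -[].
rewrite (P_setD1 aS nS) TI_cardMg.
  by rewrite (IHn _ cS1 clS') card_root_group cS1 cS expnSr.
apply/trivgP/subsetP => y; rewrite inE (P_set1 xF) => /andP[yS /imsetP[t _ ey]].
rewrite ey (_ : t = 0%R) ?(family0 xF) ?inE //.
apply: (family_free xF (a := a)); rewrite -ey; apply: subsetP yS.
apply: P_mono; apply/subsetP => b; rewrite !inE => /andP[ba /amin].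
by rewrite leq_eqVlt => /orP[/eqP/val_inj e|//]; rewrite e eqxx in ba.
Qed.

Lemma normal_closed N S : pattern_normal N S -> closed_pattern N.
Proof.
move=> /pattern_normalP[/subsetP NS h]; rewrite closed_normal.
by apply/pattern_normalP; split=> // a b c aN /NS bS; apply: h bS.
Qed.

(** The intersection is trivial for reasons of order. *)
Lemma P_TI_setD1 S a : closed_pattern S -> a \in S -> pattern_normal (S :\ a) S ->
  P (S :\ a) ><| P [set a] = P S.
Proof.
move=> clS aS nS; have n := normal_norm (P_normal xF nS).
have naS : P [set a] \subset 'N(P (S :\ a)).
  by apply: subset_trans n; apply: P_mono; rewrite sub1set.
rewrite sdprodE //; first by rewrite -P_setD1.
apply: cardMg_TI; rewrite -P_setD1 // card_root_group !card_P ?(normal_closed nS) //.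
by rewrite -expnSr (cardsD1 a S) aS.
Qed.

(** The derived subgroup of P(S) together with P(N) is P(Q) with Q the union of N
    and of the sums of roots of S: commutators of root elements lie in P(Q), and
    conversely they generate the root subgroups of the sums ([comm_root_sub]). *)
Lemma card_abelianization S N : closed_pattern S -> pattern_normal N S ->
  #|P S / P N : (P S / P N)^`(1)| = (#|F| ^ (#|S| - #|N :|: root_sums S|))%N.
Proof.
move=> clS nNS; have := clS; rewrite closed_normal => /pattern_normalP[_ cl].
have [NS hN] := pattern_normalP _ _ nNS.
set Q := N :|: root_sums S.
have QS : Q \subset S.
  rewrite subUset NS; apply/subsetP => c /root_sumsP[a [b [aS bS abc]]].
  exact: cl abc.
have nQS : pattern_normal Q S.
  apply/pattern_normalP; split=> // a b c /(subsetP QS) aS bS abc.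
  by rewrite inE; apply/orP; right; apply/root_sumsP; exists a, b.
have nN := normal_norm (P_normal xF nNS).
have F0 : (0 < #|F|)%N by apply/card_gt0P; exists 0%R.
have defQ : (P S)^`(1) <*> P N = P Q.
  apply/eqP; rewrite eqEsubset join_subG (P_mono x (subsetUl _ _)) andbT.
  apply/andP; split.
    rewrite dergSn derg0; apply: (P_comm_sub xF nQS) => // a b c aS bS abc.
    by rewrite inE; apply/orP; right; apply/root_sumsP; exists a, b.
  apply: P_subset => c t; rewrite inE => /orP[cN|].
    by apply: subsetP (joing_subr _ _) _ _; apply: mem_P.
  case/root_sumsP=> a [b [aS bS abc]]; apply: subsetP (joing_subl _ _) _ _.
  have := comm_root_sub xF (M := ((P S)^`(1))%G) abc.
  move=> /(_ _)/subsetP; apply; last exact: mem_root_group.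
  by move=> s u; rewrite /= dergSn derg0; apply: mem_commg; apply: mem_P.
have defD : (P S / P N)^`(1) = P Q / P N.
  rewrite -quotient_der // -defQ quotientYidr //.
  exact: subset_trans (der_sub 1 _) nN.
have nNQ : P N <| P Q.
  apply: normalS (P_normal xF nNS); apply: P_mono => //; exact: subsetUl.
have cQN : closed_pattern Q := normal_closed nQS.
have cN : closed_pattern N := normal_closed nNS.
have NQ : N \subset Q by apply: subsetUl.
rewrite defD -divgS ?quotientS ?P_mono // !card_quotient ?(normal_norm nNQ) //.
rewrite -!divgS ?P_mono // !card_P // -!expnB ?subset_leq_card //.
  by rewrite subnBA ?subset_leq_card // subnK ?subset_leq_card.
by rewrite leq_sub2r // subset_leq_card.
Qed.
End PatternOrders.

(** * The root elements of the adjoint representation *)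

Lemma wt_add4 (a : posroot) : wt (4 + a) = coef a.
Proof. by rewrite /wt /= addKn /all_roots nth_cat /= ltn_ord. Qed.

Lemma wt_mem (i : 'I_52) : wt i \in 0 :: all_roots.
Proof.
have /allP : all (fun i => wt i \in 0 :: all_roots) (iota 0 52) by vm_compute.
by apply; rewrite mem_iota ltn_ord.
Qed.

Lemma wt_index (i : 'I_52) r : wt i = r -> r != 0 -> i = (4 + index r all_roots)%N :> nat.
Proof.
move=> <-; rewrite /wt; case: ltnP => [_|i4 _]; first by rewrite eqxx.
have u : uniq all_roots by vm_compute.
have sz : size all_roots = (52 - 4)%N by vm_compute.
by rewrite index_uniq ?subnKC // sz ltn_sub2r // (leq_ltn_trans i4).
Qed.

(** The reason why the root elements are unitriangular: adding a positive root once
    or twice to a positive root leads to a later positive root or out of the system. *)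
Lemma shift_check :
  all (fun a => let r := nth 0 pos_roots a in
    [&& r + r \notin 0 :: all_roots, index r all_roots == a &
     all (fun j => let s := nth 0 pos_roots j in
       all (fun v => (v \in 0 :: all_roots) ==>
              (v != 0) && (j < index v all_roots < 24)%N) [:: r + s; r + (r + s)])
     (iota 0 24)]) (iota 0 24).
Proof. by vm_compute. Qed.

(** Some element of the Cartan part detects the root a in odd characteristic. *)
Lemma cartan_check :
  all (fun a => has (fun i => absz (cartan (nth 0 pos_roots a) (nth 0 pos_roots i))
    \in [:: 1; 2]%N) (iota 0 4)) (iota 0 24).
Proof. by vm_compute. Qed.

Section Concrete.
Variables (F : finFieldType).
Hypothesis two_neq0 : 2%:R != 0 :> F.
Implicit Types (a b c : posroot) (s t : F).

Lemma ad_root_wt a (i j : 'I_52) : ad_root F a i j != 0 -> wt i = coef a + wt j.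
Proof.
rewrite mxE -wt_add4 => h; apply: lie_const_wt => //.
  by rewrite (ltn_add2l 4 a 48) (leq_trans (ltn_ord a)).
by apply: contraNneq h => ->.
Qed.

Lemma ad_root_sq_wt a (i j : 'I_52) :
  (ad_root F a ^+ 2) i j != 0 -> wt i = coef a + (coef a + wt j).
Proof.
rewrite expr2 mxE; have [k hk _|h0] := pickP (fun k => ad_root F a i k * ad_root F a k j != 0).
  by move: hk; rewrite mulf_eq0 negb_or => /andP[/ad_root_wt-> /ad_root_wt->].
by rewrite big1 ?eqxx // => k _; have /negbFE/eqP := h0 k.
Qed.

(** The basis vectors 0, ..., 3 span the Cartan part and 4, ..., 27 are the positive
    root vectors.  The condition says that M - 1 maps the Cartan part into the span of
    the root vectors number n and later, and each positive root vector into the span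
    of the later ones. *)
Definition raising (n : nat) (M : 'M[F]_52) : bool :=
  [forall i : 'I_52, forall j : 'I_52, ((j < 28)%N && (M i j != (i == j)%:R)) ==>
    ((if (j < 4)%N then 4 + n else j.+1) <= i < 28)%N].

Lemma raisingP n (M : 'M[F]_52) : reflect
  (forall i j : 'I_52, (j < 28)%N -> M i j != (i == j)%:R ->
     ((if (j < 4)%N then 4 + n else j.+1) <= i < 28)%N) (raising n M).
Proof.
apply: (iffP forallP) => [h i j j28 hM|h i].
  by have /forallP/(_ j) := h i; rewrite j28 hM.
by apply/forallP => j; apply/implyP => /andP[j28 hM]; apply: h.
Qed.

Lemma raising_group_set n : group_set [set g : {'GL_52[F]} | raising n (val g)].
Proof.
apply/group_setP; split.
  by rewrite inE; apply/raisingP => i j _; rewrite /= mxE eqxx.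
move=> g h; rewrite !inE => /raisingP hg /raisingP hh.
apply/raisingP => i j j28; rewrite (_ : val (g * h)%g = val g *m val h) //.
move: (val g) (val h) hg hh => A B hA hB; rewrite mxE => hM.
have [k hk] : exists k, A i k * B k j != (i == k)%:R * (k == j)%:R.
  apply/existsP; apply: contraNT hM => /existsPn h0.
  rewrite (eq_bigr (fun k => (i == k)%:R * (k == j)%:R)) => [|k _]; last first.
    by have /negPn/eqP := h0 k.
  rewrite (bigD1 i) //= eqxx mul1r big1 ?addr0 // => k ki.
  by rewrite eq_sym (negPf ki) mul0r.
have [eB|nB] := eqVneq (B k j) (k == j)%:R.
  move: hk; rewrite eB; have [->|kj] := eqVneq k j; last by rewrite !mulr0 eqxx.
  by rewrite !mulr1; apply: hA.
have /andP[k1 k28] := hB _ _ j28 nB.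
have [eA|nA] := eqVneq (A i k) (i == k)%:R.
  move: hk; rewrite eA; have [->|ik] := eqVneq i k; last by rewrite !mul0r eqxx.
  by rewrite k1 k28.
have /andP[i1 ->] := hA _ _ k28 nA; rewrite andbT.
apply: leq_trans i1; have k4 : (4 <= k)%N.
  apply: leq_trans k1; case: (ltnP j 4) => [_|/leqW //]; exact: leq_addr.
by rewrite [in leqRHS]ltnNge k4 /=; apply: leq_trans k1 (leqnSn _).
Qed.

Lemma xroot_raising a t n : (n <= a)%N -> raising n (val (xroot a t)).
Proof.
move=> na; apply/raisingP => i j j28 hM.
have /and3P[r2 /eqP ia hj] : let r := coef a in
    [&& r + r \notin 0 :: all_roots, index r all_roots == a &
     all (fun j => let s := nth 0 pos_roots j in
       all (fun v => (v \in 0 :: all_roots) ==>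
              (v != 0) && (j < index v all_roots < 24)%N) [:: r + s; r + (r + s)])
     (iota 0 24)].
  by apply: (allP shift_check); rewrite mem_iota ltn_ord.
have a0 : coef a != 0.
  by apply: contraNneq r2 => ->; rewrite addr0 inE eqxx.
have [v [hv iv]] : exists v, v \in [:: coef a + wt j; coef a + (coef a + wt j)] /\ wt i = v.
  have [n1|n1] := eqVneq (ad_root F a i j) 0; last first.
    by exists (coef a + wt j); rewrite inE eqxx (ad_root_wt n1).
  have [n2|n2] := eqVneq ((ad_root F a ^+ 2) i j) 0; last first.
    by exists (coef a + (coef a + wt j)); rewrite !inE eqxx orbT (ad_root_sq_wt n2).
  case/negP: hM; rewrite /= exp_adE !mxE.
  by move: n1 n2; rewrite !mxE => -> ->; rewrite !mulr0 !addr0.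
case: (ltnP j 4) => j4.
  have wj : wt j = 0 by rewrite /wt j4.
  move: hv; rewrite wj addr0 !inE => /orP[]/eqP ev; last first.
    by case/negP: r2; rewrite -ev -iv wt_mem.
  by rewrite (wt_index iv) ev // ia leq_add2l na (leq_trans _ (_ : 4 + 24 <= 28)%N) ?ltn_add2l.
have wj : wt j = nth 0 pos_roots (j - 4).
  by rewrite /wt ltnNge j4 /= /all_roots nth_cat (_ : size _ = 24)%N // ltn_subLR // j28.
have j24 : (j - 4)%N \in iota 0 24 by rewrite mem_iota /= ltn_subLR.
move: (allP hj _ j24); rewrite -wj => /allP/(_ v hv); rewrite -iv wt_mem implyTb.
case/and3P=> v0 v1 v2; rewrite (wt_index erefl v0).
move: (index _ _) v1 v2 => m v1 v2.
by rewrite -{1}(subnKC j4) ltn_add2l v1 (ltn_add2l 4 m 24).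
Qed.

(** By [xroot_raising] the elements of the group of the later roots do not change the
    Cartan part in the direction of e_a, while x_a(t) adds to the coroot of a simple
    root b the multiple - t <a, b^vee> e_a. *)
Lemma xroot_free a t : xroot a t \in P F [set b : posroot | (a < b)%N] -> t = 0.
Proof.
have sub : P F [set b : posroot | (a < b)%N] \subset group (raising_group_set a.+1).
  rewrite gen_subG; apply/bigcupsP => b; rewrite inE => ab.
  by apply/subsetP => g /imsetP[s _ ->]; rewrite inE xroot_raising.
move=> /(subsetP sub); rewrite inE => /raisingP h.
have ca := allP cartan_check a; rewrite mem_iota ltn_ord in ca.
have /hasP[k hk /(small_int_neq0 two_neq0) C0] := ca isT.
have k4 : (k < 4)%N by rewrite mem_iota in hk.
have [k52 a52] : (k < 52)%N /\ (4 + a < 52)%N.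
  by split; [apply: leq_trans k4 _ | rewrite (ltn_add2l 4 a 48) (leq_trans (ltn_ord a))].
pose i := Ordinal a52; pose j := Ordinal k52.
have [|e] := eqVneq (val (xroot a t) i j) (i == j)%:R; last first.
  have := h i j (leq_trans k4 _) e; rewrite /= k4 leq_add2l ltnn.
  by move=> /(_ isT).
have ij : i == j = false by apply: contraTF k4 => /eqP/(congr1 val)/= <-; rewrite -leqNgt leq_addr.
have wj : wt j = 0 by rewrite /wt k4.
have a0 : coef a != 0.
  have /allP chk : all (fun a : nat => nth 0 pos_roots a != 0) (iota 0 24) by vm_compute.
  by apply: chk; rewrite mem_iota ltn_ord.
have A1 : ad_root F a i j = - (cartan (coef a) (nth 0 pos_roots k))%:~R.
  by rewrite mxE /lie_const [(4 + a < 4)%N]ltnNge leq_addr /= k4 eqxx wt_add4 rmorphN.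
have A2 : (ad_root F a ^+ 2) i j = 0.
  apply/eqP; apply: contraNT a0 => /ad_root_sq_wt.
  by rewrite wj addr0 wt_add4 => /eqP; rewrite -subr_eq0 opprD addrA subrr add0r oppr_eq0.
have -> : val (xroot a t) i j = (i == j)%:R +
    (t * ad_root F a i j + t ^+ 2 / 2%:R * (ad_root F a ^+ 2) i j).
  by rewrite /= exp_adE !mxE.
rewrite A1 A2 mulr0 addr0 ij add0r mulrN => /eqP.
by rewrite oppr_eq0 mulf_eq0 (negPf C0) orbF => /eqP.
Qed.

Lemma xroot_family : chevalley_family (@xroot F).
Proof.
split=> //; [exact: xrootD|exact: xroot_comm0|exact: xroot_comm_sum|exact: xroot_free].
Qed.
End Concrete.

(** * Removing one arm root *)

Definition Irr_over (gT : finGroupType) (G : {group gT}) (K Z : {set gT}) : pred 'CF(G) :=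
  [pred chi | [&& chi \in irr G, K \subset cfker chi & ~~ (Z \subset cfker chi)]].
Arguments Irr_over {gT} G K Z chi.

Lemma irr1_ge1 (gT : finGroupType) (G : {group gT}) (chi : 'CF(G)) :
  chi \in irr G -> 1 <= chi 1%g.
Proof.
case/irrP=> i ->; have /natrP[n en] := Cnat_irr1 i; have := irr1_gt0 i.
by rewrite en ltr0n ler1n.
Qed.

Section CentralCharacters.
Variables (gT : finGroupType) (G : {group gT}).
Implicit Types (K A : {set gT}).

Lemma cfcenter_mul (chi : 'CF(G)) z g : chi \is a character ->
  z \in ('Z(chi)%CF)%g -> g \in G -> chi (z * g)%g * chi 1%g = chi z * chi g.
Proof.
case/char_reprP=> rG ->; rewrite cfcenter_repr inE.
case: rG => n rG /= /andP[zG /is_scalar_mxP[a ea]] gG.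
rewrite !cfunE groupM ?group1 ?zG ?gG //= !mulr1n repr_mxM // repr_mx1 ea.
rewrite mul_scalar_mx !linearZ /= mxtrace1 mxtrace_scalar.
by rewrite -[in RHS]mulr_natr mulrAC.
Qed.

(** The center of an irreducible character is the preimage of the center of the
    quotient by its kernel. *)
Lemma comm_sub_cfcenter (i : Iirr G) (A : {set gT}) :
  A \subset G -> [~: A, G]%g \subset cfker 'chi_i -> A \subset 'Z('chi_i)%CF.
Proof.
move=> AG cAG; have nK := normal_norm (cfker_normal 'chi_i).
rewrite -(quotientSGK (subset_trans AG nK)) ?(normal_sub (cfker_center_normal _)) //.
rewrite cfcenter_eq_center subsetI quotientS // quotient_cents2 //.
exact: subset_trans AG nK.
Qed.
End CentralCharacters.

Section ArmLegStep.
Variables (gT : finGroupType) (G H K D Z : {group gT}).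
Hypotheses (nHG : H <| G) (nKG : K <| G) (KH : K \subset H) (DH : D \subset H).
Hypothesis (ZH : Z \subset H).
Hypotheses (cDH : [~: D, H]%g \subset K) (cZG : [~: Z, G]%g \subset K).
Hypothesis arm_moves : forall g w, g \in G -> g \notin H -> w \in Z ->
  exists2 d, d \in D & [~ d, g]%g \in (w *: K)%g.
Hypothesis leg_moves : forall d w, d \in D -> d \notin K -> w \in Z ->
  exists2 g, g \in G & [~ d, g]%g \in (w *: K)%g.

Let HG : H \subset G := normal_sub nHG.

(** Conjugation by y moves D modulo K to all of Z: if both characters are trivial on
    D and conjugate by y, then they are trivial on Z. *)
Lemma conjg_arm_neq (i j : Iirr H) y : Irr_over H (K :|: D) Z 'chi_i ->
  Irr_over H (K :|: D) Z 'chi_j -> y \in G -> y \notin H -> 'chi_i <> ('chi_j ^ y)%CF.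
Proof.
move=> /and3P[_ ki _] /and3P[_ kj /negP nZ] yG yH eij; case: nZ.
have nyH := subsetP (normal_norm nHG) y yG.
have e1 : 'chi_i 1%g = 'chi_j 1%g by rewrite eij cfConjg1.
apply/subsetP => w wZ; rewrite cfkerEirr inE.
have [|d dD /lcosetP[k kK dyw]] := arm_moves (groupVr yG) _ wZ; first by rewrite groupV.
rewrite -e1.
have Dk (l : Iirr H) : K :|: D \subset cfker 'chi_l -> d \in cfker 'chi_l.
  by move=> /subsetP; apply; rewrite inE dD orbT.
have kk : k \in cfker 'chi_j by apply: (subsetP kj); rewrite inE kK.
have : 'chi_i d = 'chi_i 1%g by apply/eqP; have := Dk _ ki; rewrite cfkerEirr inE.
move=> <-; rewrite {1}eij cfConjgE // conjg_mulR dyw (cfkerMl _ (Dk _ kj)).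
by rewrite cfkerMr.
Qed.

(** Mackey: only the conjugates by elements of H contribute. *)
Lemma cfdot_Ind_arm (i j : Iirr H) : Irr_over H (K :|: D) Z 'chi_i ->
  Irr_over H (K :|: D) Z 'chi_j ->
  '['Ind[G] 'chi_i, 'Ind[G] 'chi_j] = (i == j)%:R.
Proof.
move=> oi oj; rewrite -cfdot_Res_r cfResInd // cfdotZr cfdot_sumr.
rewrite (bigID (mem H)) /= [X in _ + X]big1 ?addr0; last first.
  move=> y /andP[yG yH]; rewrite -conjg_IirrE cfdot_irr; case: eqP => // e.
  by case: (conjg_arm_neq oi oj yG yH); rewrite -conjg_IirrE -e.
rewrite (eq_bigr (fun _ => (i == j)%:R)) => [|y /andP[_ yH]]; last first.
  by rewrite cfConjg_id ?cfdot_irr //.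
rewrite sumr_const (_ : #|_| = #|H|); last first.
  apply: eq_card => y; rewrite -[LHS]/((y \in G) && (y \in H)).
  by rewrite andb_idl // => /(subsetP HG).
by rewrite conj_Creal ?rpredV ?rpred_nat // -[_ *+ #|H|]mulr_natl mulKf ?neq0CG.
Qed.

(** A conjugate of d is d w modulo the kernel, and w can be chosen to act by a scalar
    different from 1. *)
Lemma leg_char_vanish (i : Iirr G) d : Irr_over G K Z 'chi_i -> d \in D ->
  d \notin K -> 'chi_i d = 0.
Proof.
move=> /and3P[_ ki nZ] dD dK.
have zZ : Z \subset 'Z('chi_i)%CF.
  by apply: comm_sub_cfcenter; [apply: subset_trans HG | apply: subset_trans ki].
have [w wZ nw] := subsetPn nZ; have [g gG /lcosetP[k kK dg]] := leg_moves dD dK wZ.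
have dG : d \in G := subsetP (subset_trans DH HG) d dD.
rewrite cfkerEirr inE in nw.
have e : 'chi_i d * 'chi_i 1%g = 'chi_i w * 'chi_i d.
  rewrite -(cfcenter_mul (irr_char i) (subsetP zZ w wZ) dG); congr (_ * _).
  have wG : w \in G by apply: subsetP wZ; apply: subset_trans HG.
  rewrite -(cfunJ _ _ gG) conjg_mulR dg mulgA (cfkerMr _ (subsetP ki k kK)).
  by rewrite -(cfunJ 'chi_i (d * w) dG) conjgE !mulgA mulVg mul1g.
apply/eqP; move/eqP: e; rewrite mulrC -subr_eq0 -mulrBl mulf_eq0 subr_eq0.
by rewrite eq_sym (negPf nw).
Qed.

Lemma join_central_normal : (K <*> Z)%G <| G.
Proof.
have ZG := subset_trans ZH HG; have nK := normal_norm nKG.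
rewrite /normal join_subG (normal_sub nKG) ZG /=.
apply/subsetP => g gG; rewrite inE -genJ gen_subG conjUg subUset.
rewrite (normsP nK g gG) joing_subl /=; apply/subsetP => _ /imsetP[w wZ ->].
rewrite conjg_mulR groupM //; first by apply: subsetP wZ; apply: joing_subr.
by apply: (subsetP (joing_subl K Z)); apply: (subsetP cZG); apply: mem_commg.
Qed.

(** By [leg_char_vanish] the multiplicity of the trivial character in the restriction
    to D is positive.  So some constituent on H contains the trivial character of D,
    and it is a multiple of it there, as D is central in H modulo K. *)
Lemma leg_trivial_constt (i : Iirr G) : Irr_over G K Z 'chi_i ->
  exists2 j, j \in irr_constt ('Res[H] 'chi_i) & K :|: D \subset cfker 'chi_j.
Proof.
move=> oi; have /and3P[_ ki nZ] := oi; have DG := subset_trans DH HG.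
have nz : '['Res[H] 'chi_i, 'Ind[H] (1 : 'CF(D))] != 0.
  rewrite -cfdot_Res_l cfResRes // cfdotE mulf_neq0 ?invr_eq0 ?neq0CG //.
  rewrite (bigID (mem K)) /= [X in _ + X]big1 ?addr0 => [|d /andP[dD dK]]; last first.
    by rewrite cfResE // (leg_char_vanish oi) ?mul0r.
  rewrite (eq_bigr (fun _ => 'chi_i 1%g)) => [|d /andP[dD dK]]; last first.
    rewrite cfResE // cfun1E dD conjC1 mulr1.
    by have := subsetP ki d dK; rewrite cfkerEirr inE => /eqP.
  rewrite sumr_const -mulr_natr mulf_neq0 ?irr1_neq0 // pnatr_eq0 -lt0n.
  by apply/card_gt0P; exists 1%g; rewrite unfold_in /= !group1.
have [j nz1 nz2] : exists2 j, '['Res[H] 'chi_i, 'chi_j] != 0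
    & '['Ind[H] (1 : 'CF(D)), 'chi_j] != 0.
  have [j hj|h0] := pickP (fun j =>
    ('['Res[H] 'chi_i, 'chi_j] != 0) && ('['Ind[H] (1 : 'CF(D)), 'chi_j] != 0)).
    by case/andP: hj => *; exists j.
  case/negP: nz; rewrite cfdot_sum_irr big1 // => j _.
  have := h0 j; case: eqP => [->|_] /=; first by rewrite mul0r.
  by move=> /negbFE/eqP->; rewrite conjC0 mulr0.
have kj : K \subset cfker 'chi_j.
  apply: subset_trans (cfker_constt (cfRes_char _ (irr_char i)) _).
    2: by rewrite irr_consttE; exact: nz1.
  by rewrite cfker_Res ?irr_char // subsetI KH.
exists j; first by rewrite irr_consttE.
rewrite subUset kj /=.
have dZ : D \subset 'Z('chi_j)%CF by apply: comm_sub_cfcenter => //; apply: subset_trans kj.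
have [mu Lmu emu] := cfcenter_Res 'chi_j.
have eD : 'Res[D] 'chi_j = 'chi_j 1%g *: 'Res[D] mu.
  by rewrite -(cfResRes _ dZ (cfcenter_sub _)) emu linearZ.
have /lin_char_irr/irrP[l el] := cfRes_lin_char D Lmu.
have l0 : l = 0.
  apply/eqP; apply: contraNT nz2 => l0; rewrite -cfdot_Res_r eD cfdotZr el.
  by rewrite -irr0 cfdot_irr [0 == l]eq_sym (negPf l0) mulr0.
apply/subsetP => d dD; rewrite cfkerEirr inE -(cfResE _ DH dD) eD el l0 irr0 cfunE.
by rewrite cfun1E dD mulr1.
Qed.

Lemma central_cfker_Ind (j : Iirr H) : K \subset cfker 'chi_j ->
  (Z \subset cfker ('Ind[G] 'chi_j)) = (Z \subset cfker 'chi_j).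
Proof.
move=> kj; rewrite cfker_Ind_irr //; apply/idP/idP => h.
  exact: subset_trans h (gcore_sub _ _).
apply: subset_trans (joing_subr K Z) _.
by rewrite sub_gcore ?(normal_norm join_central_normal) // join_subG kj.
Qed.

(** The elements of G outside H play the part of the arm, D that of the leg;
    [arm_moves] and [leg_moves] say that commutation pairs them nondegenerately
    into Z modulo K. *)
Theorem arm_leg_step :
  one_to_one (Irr_over H (K :|: D) Z) (Irr_over G K Z) 'Ind[G].
Proof.
have irrI (j : Iirr H) : Irr_over H (K :|: D) Z 'chi_j -> 'Ind[G] 'chi_j \in irr G.
  by move=> oj; rewrite irrEchar cfInd_char ?irr_char // (cfdot_Ind_arm oj oj) !eqxx.
split=> [phi|phi psi|theta].
- move=> oj; have /and3P[/irrP[j ej] kj zj] := oj; rewrite ej in oj kj zj *.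
  have {}kj : K \subset cfker 'chi_j by apply: subset_trans kj; apply: subsetUl.
  rewrite /Irr_over /= irrI // central_cfker_Ind // zj andbT.
  by rewrite cfker_Ind_irr // sub_gcore // normal_norm.
- move=> oi oj; have /and3P[/irrP[i ei] _ _] := oi; have /and3P[/irrP[j ej] _ _] := oj.
  rewrite ei ej in oi oj * => e; congr ('chi_ _); apply/eqP.
  have := cfdot_Ind_arm oi oj; rewrite -e cfdot_Ind_arm // eqxx => /esym/eqP.
  by rewrite pnatr_eq1 eqb1.
- move=> ot; have /and3P[/irrP[i ei] ki zi] := ot; rewrite ei in ot ki zi *.
  have [j ij kj] := leg_trivial_constt ot.
  have kKj : K \subset cfker 'chi_j by apply: subset_trans kj; apply: subsetUl.
  have hi : i \in irr_constt ('Ind[G] 'chi_j) by rewrite constt_Ind_Res.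
  have oj : Irr_over H (K :|: D) Z 'chi_j.
    rewrite /Irr_over /= mem_irr kj; apply: contra zi; rewrite -central_cfker_Ind // => h.
    by apply: subset_trans h (cfker_constt _ hi); rewrite cfInd_char ?irr_char.
  exists 'chi_j => //; have /irrP[l el] := irrI _ oj.
  by move: hi; rewrite el constt_irr inE => /eqP->.
Qed.
End ArmLegStep.

(** * Removing arm roots from patterns *)

Section PatternSteps.
Variables (F : finFieldType) (gT : finGroupType) (x : posroot -> F -> gT).
Hypothesis xF : chevalley_family x.
Local Notation P := (pattern_group x).
Implicit Types (a b c d g z : posroot) (A B S T N K Q : {set posroot}).

Definition Irr_pattern S K z : pred 'CF(P S) := Irr_over (P S) (P K) (P [set z]).
Arguments Irr_pattern S K z chi : clear implicits.

Lemma P_setU_sub A B (G : {group gT}) :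
  (P (A :|: B) \subset G) = (P A \subset G) && (P B \subset G).
Proof. by rewrite P_setU join_subG. Qed.

Lemma Irr_overE (G : {group gT}) (A Z : {set gT}) (chi : 'CF(G)) :
  Irr_over G A Z chi = [&& chi \in irr G, A \subset cfker chi & ~~ (Z \subset cfker chi)].
Proof. by []. Qed.

Lemma Irr_pattern_setU S K K' z chi : Irr_pattern S (K :|: K') z chi =
  (P K' \subset cfker chi) && Irr_pattern S K z chi.
Proof. by rewrite /Irr_pattern !Irr_overE P_setU_sub andbCA -!andbA; do !bool_congr. Qed.

(** The second factor of the commutator disappears modulo P(K). *)
Lemma comm_leading K d g z : is_sum d g z ->
  (forall e, is_sum z d e -> e \in K) -> (forall e, is_sum z g e -> e \in K) ->
  exists2 C : F, C != 0 &
    forall s t, [~ x d s, x g t]%g \in (x z (C * s * t)%R *: P K)%g.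
Proof.
move=> dgz zd zg; have [C C0 h] := family_comm_sum xF dgz; exists C => // s t.
rewrite mem_lcoset; case: h => [->|[e [D [_ /zd eK ->]]]|[e [D [_ /zg eK ->]]]].
- by rewrite mulVg group1.
- by rewrite mulKg mem_P.
- by rewrite mulKg mem_P.
Qed.

(** The situation in which g can be removed from the pattern S and d added to the
    kernel K: d is central modulo K except for its commutators with g, which lead to
    the central root z. *)
Definition arm_leg_pair S K z g d : Prop :=
  [/\ is_sum d g z, [/\ g \in S, g \notin K, d \in S & z \in S],
      pattern_normal (S :\ g) S, pattern_normal K S &
      (forall b c, b \in S -> is_sum z b c -> c \in K) /\
      (forall b c, b \in S -> b != g -> is_sum d b c -> c \in K)].

Lemma pattern_step S K z g d : arm_leg_pair S K z g d ->
  one_to_one (Irr_pattern (S :\ g) (K :|: [set d]) z) (Irr_pattern S K z) 'Ind[P S].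
Proof.
case=> dgz [gS gK dS zS] nT nK [cz cd].
have dg : d != g by apply: contraTneq dgz => ->; apply: coef_double_nroot.
have zg : z != g.
  by apply: contraTneq dgz => ->; rewrite /is_sum -subr_eq0 opprD addrCA subrr addr0
     oppr_eq0; apply/eqP => e; have := coef_double_nroot d d; rewrite /is_sum e addr0 eqxx.
have dT : d \in S :\ g by rewrite !inE dg.
have zT : z \in S :\ g by rewrite !inE zg.
have [KS _] := pattern_normalP _ _ nK.
have KT : K \subset S :\ g by rewrite subsetD1 KS.
have nPK := normal_norm (P_normal xF nK).
have [C C0 lead] : exists2 C : F, C != 0 &
    forall s t, [~ x d s, x g t]%g \in (x z (C * s * t)%R *: P K)%g.
  by apply: comm_leading dgz _ _ => e; [apply: cz dS | apply: cz gS].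
have cDH : [~: P [set d], P (S :\ g)]%g \subset P K.
  apply: (P_comm_sub xF nK); rewrite ?sub1set ?subD1set //.
  by move=> a b c /set1P-> /setD1P[bg bS]; apply: cd.
have step : one_to_one (Irr_over (P (S :\ g)) (P K :|: P [set d]) (P [set z]))
    (Irr_over (P S) (P K) (P [set z])) 'Ind[P S].
  apply: arm_leg_step => //.
  - exact: P_normal nT.
  - exact: P_normal nK.
  - exact: P_mono.
  - by apply: P_mono; rewrite sub1set.
  - by apply: P_mono; rewrite sub1set.
  - apply: (P_comm_sub xF nK); rewrite ?sub1set //.
    by move=> a b c /set1P-> bS; apply: cz.
  - move=> y w; rewrite (P_setD1 xF gS nT) => /mulsgP[h v hT].
    rewrite (P_set1 xF) => /imsetP[t _ ->] ->; rewrite (P_set1 xF) => yT /imsetP[u _ ->].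
    have t0 : t != 0 by apply: contraNneq yT => ->; rewrite (family0 xF) mulg1.
    exists (x d (u / (C * t))); first by rewrite (P_set1 xF) imset_f.
    (* the parameter of d for which the commutator with x_g(t) is x_z(u) *)
    have ut : C * (u / (C * t)) * t = u by rewrite mulrAC mulrC divfK ?mulf_neq0.
    rewrite commgMJ; have := lead (u / (C * t)) t; rewrite ut !mem_lcoset => hl.
    rewrite (mulgA (x z u)^-1%g) groupM // memJ_norm.
      by apply: (subsetP cDH); rewrite mem_commg ?mem_P ?set11.
    by apply: (subsetP nPK); apply: mem_P.
  - move=> y w; rewrite (P_set1 xF) => /imsetP[s _ ->] sK; rewrite (P_set1 xF) => /imsetP[u _ ->].
    have s0 : s != 0 by apply: contraNneq sK => ->; rewrite (family0 xF) group1.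
    exists (x g (u / (C * s))); first exact: mem_P.
    have us : C * s * (u / (C * s)) = u by rewrite mulrC divfK ?mulf_neq0.
    by have := lead s (u / (C * s)); rewrite us.
have eqI chi : Irr_pattern (S :\ g) (K :|: [set d]) z chi
    = Irr_over (P (S :\ g)) (P K :|: P [set d]) (P [set z]) chi.
  by rewrite /Irr_pattern !Irr_overE P_setU_sub subUset.
case: step => s1 s2 s3; split=> [phi|phi psi|theta].
- by rewrite eqI => /s1.
- by rewrite !eqI; apply: s2.
- by move=> /s3[phi ? <-]; exists phi; rewrite ?eqI.
Qed.
End PatternSteps.
Arguments Irr_pattern {F gT} x S K z chi.

Lemma one_to_one_comp (A B C : Type) (D : pred A) (E : pred B) (G : pred C) f g :
  one_to_one D E f -> one_to_one E G g -> one_to_one D G (g \o f).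
Proof.
case=> f1 f2 f3 [g1 g2 g3]; split=> [x Dx|x y Dx Dy /= /g2 e|z /g3[y /f3[x Dx <-] <-]].
- by apply: g1; apply: f1.
- by apply: f2 => //; apply: e; apply: f1.
- by exists x.
Qed.

Lemma eq_one_to_one (A B : Type) (D : pred A) (E : pred B) f g :
  f =1 g -> one_to_one D E f -> one_to_one D E g.
Proof.
move=> fg [f1 f2 f3]; split=> [x /f1|x y|z /f3[x Dx <-]]; rewrite -?fg //.
  exact: f2.
by exists x; rewrite -?fg.
Qed.

(** Out of range (24) if the sum is not a root; tabulated, as the checks below consult
    it many times. *)
Definition sum_table : seq (seq nat) := Eval vm_compute in
  mkseq (fun i => mkseq (fun j =>
    index (nth 0 pos_roots i + nth 0 pos_roots j) pos_roots) 24) 24.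

Definition root_add (i j : nat) : nat := nth 24%N (nth [::] sum_table i) j.

Lemma is_sumE (a b c : posroot) : is_sum a b c = (root_add a b == c).
Proof.
have -> : root_add a b = index (coef a + coef b) pos_roots.
  rewrite /root_add (_ : sum_table = mkseq (fun i => mkseq (fun j =>
    index (nth 0 pos_roots i + nth 0 pos_roots j) pos_roots) 24) 24).
    by rewrite nth_mkseq ?ltn_ord // nth_mkseq ?ltn_ord.
  by vm_cast_no_check (erefl sum_table).
apply/eqP/eqP => [<-|e].
  by rewrite /coef index_uniq ?ltn_ord //; vm_compute.
by rewrite {1}/coef -e nth_index // -index_mem e ltn_ord.
Qed.

Definition pat (l : seq nat) : {set posroot} := [set b : posroot | (b : nat) \in l].

Definition absorbs (N S K : seq nat) : bool :=
  all (fun i => all (fun j => let k := root_add i j in (24 <= k)%N || (k \in K)) S) N.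

Lemma absorbsP N S K : absorbs N S K -> forall a b c : posroot,
  a \in pat N -> b \in pat S -> is_sum a b c -> c \in pat K.
Proof.
move=> /allP h a b c; rewrite !inE is_sumE => aN bS /eqP e.
by have := allP (h a aN) b bS; rewrite /= e leqNgt ltn_ord.
Qed.

Lemma pat_normal N S : all (mem S) N -> absorbs N S N -> pattern_normal (pat N) (pat S).
Proof.
move=> /allP NS h; apply/pattern_normalP; split; last exact: absorbsP h.
by apply/subsetP => a; rewrite !inE => /NS.
Qed.

Definition remove (S : seq nat) (g : nat) : seq nat := [seq i <- S | i != g].

Lemma pat_remove S (g : posroot) : pat (remove S g) = pat S :\ g.
Proof. by apply/setP => b; rewrite !inE mem_filter. Qed.

Lemma pat_cons K (d : posroot) : pat ((d : nat) :: K) = pat K :|: [set d].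
Proof. by apply/setP => b; rewrite !inE orbC. Qed.

(** A computable form of [arm_leg_pair], for patterns given by lists. *)
Definition pair_ok (z : nat) (S K : seq nat) (p : nat * nat) : bool :=
  let: (g, d) := p in
  [&& (g < 24)%N, (d < 24)%N, root_add d g == z, g \in S & g \notin K] &&
  [&& d \in S, z \in S, absorbs (remove S g) S (remove S g), all (mem S) K & absorbs K S K] &&
  [&& absorbs [:: z] S K & absorbs [:: d] (remove S g) K].

Lemma pair_okP (z g d : posroot) S K : pair_ok z S K (g : nat, d : nat) ->
  arm_leg_pair (pat S) (pat K) z g d.
Proof.
case/andP=> /andP[/and5P[_ _ dgz gS gK] /and5P[dS zS nT KS nK]] /andP[cz cd].
split; rewrite ?is_sumE //; first by rewrite !inE.
- by rewrite -pat_remove; apply: pat_normal => //; apply/allP => i; rewrite mem_filter => /andP[].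
- exact: pat_normal.
- split=> [b c bS|b c bS bg]; first by apply: absorbsP cz _ _ _ _ bS; rewrite !inE.
  by apply: absorbsP cd _ _ _ _ _; rewrite ?pat_remove !inE ?eqxx // bg; rewrite inE in bS.
Qed.

Fixpoint peelable (z : nat) (S K : seq nat) (l : seq (nat * nat)) : bool :=
  if l is p :: l' then pair_ok z S K p && peelable z (remove S p.1) (p.2 :: K) l'
  else true.

Definition peel_source (S : seq nat) (l : seq (nat * nat)) :=
  foldl (fun S p => remove S p.1) S l.
Definition peel_kernel (K : seq nat) (l : seq (nat * nat)) :=
  foldl (fun K p => p.2 :: K) K l.

Section Peeling.
Variables (F : finFieldType) (gT : finGroupType) (x : posroot -> F -> gT).
Hypothesis xF : chevalley_family x.
Local Notation P := (pattern_group x).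
Implicit Types (a b c d g z : posroot) (S K : seq nat).

Lemma peel_sub S l : pat (peel_source S l) \subset pat S.
Proof.
elim: l S => [|p l IHl] S //=; apply: subset_trans (IHl _) _.
by apply/subsetP => b; rewrite !inE mem_filter => /andP[].
Qed.

(** Iterates [pattern_step], by transitivity of induction. *)
Theorem peel_bijection z S K l : peelable z S K l ->
  one_to_one (Irr_pattern x (pat (peel_source S l)) (pat (peel_kernel K l)) z)
    (Irr_pattern x (pat S) (pat K) z) 'Ind[P (pat S)].
Proof.
elim: l S K => [|[g d] l IHl] S K /=.
  move=> _; apply: (@eq_one_to_one _ _ _ _ id) => [phi|]; first by rewrite cfInd_id.
  by split=> // chi; exists chi.
case/andP=> h hl; have [g24 d24] : (g < 24)%N /\ (d < 24)%N.
  by case/andP: h => /andP[/and5P[]].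
have := pair_okP (g := Ordinal g24) (d := Ordinal d24) h.
move/(pattern_step xF); rewrite -pat_remove -pat_cons /= => step.
apply: (@eq_one_to_one _ _ _ _ ('Ind[P (pat S)] \o 'Ind[P (pat (remove S g))])).
  move=> phi /=; rewrite cfIndInd // ?P_mono ?peel_sub //.
  by apply: (peel_sub S [:: (g, d)]).
exact: one_to_one_comp (IHl _ _ hl) step.
Qed.

Lemma peel_index z S K l : closed_pattern (pat S) -> peelable z S K l ->
  #|P (pat S) : P (pat (peel_source S l))| = (#|F| ^ size l)%N.
Proof.
move=> clS hl; have F0 : (0 < #|F|)%N by apply/card_gt0P; exists 0.
suff [cl' e] : closed_pattern (pat (peel_source S l)) /\
     #|pat S| = (size l + #|pat (peel_source S l)|)%N.
  rewrite -divgS ?P_mono ?peel_sub // !card_P // e -expnB ?leq_addl //.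
  by rewrite addnK.
elim: l S K clS hl => [|[g d] l IHl] S K clS //= /andP[h hl].
have [g24 d24] : (g < 24)%N /\ (d < 24)%N by case/andP: h => /andP[/and5P[]].
have [_ [gS _ _ _] nT _ _] := pair_okP (g := Ordinal g24) (d := Ordinal d24) h.
have e := pat_remove S (Ordinal g24); rewrite /= in e.
have [|cl' e2] := IHl _ _ _ hl; first by rewrite e (normal_closed nT).
by split=> //; rewrite (cardsD1 (Ordinal g24)) gS -e e2.
Qed.
End Peeling.

(** * Characters of a direct product modulo a kernel *)

Section CentralProduct.
Variables (gT : finGroupType) (G K M Y Z : {group gT}).
Hypotheses (nMG : M <| G) (nYG : Y <| G) (KY : K \subset Y).
Hypotheses (defG : Y ><| Z = G) (defM : M :=: K <*> Z) (abZ : abelian Z).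
Hypothesis (cZG : [~: Z, G]%g \subset K).

Definition central_mul (x : 'CF(G / M) * 'CF(G / Y)) : 'CF(G) :=
  (x.1 %% M)%CF * (x.2 %% Y)%CF.

Let ZM : Z \subset M. Proof. by rewrite defM joing_subr. Qed.
Let KM : K \subset M. Proof. by rewrite defM joing_subl. Qed.
Let ZG : Z \subset G. Proof. exact: subset_trans ZM (normal_sub nMG). Qed.

Lemma mod_lin_char (lam : 'CF(G / Y)) :
  lam \in irr (G / Y) -> (lam %% Y)%CF \is a linear_char.
Proof.
move=> /irrP[i ->]; apply: cfMod_lin_char.
have abGY : abelian (G / Y).
  by rewrite -(sdprodW defG) quotientMidl quotient_abelian.
exact: (char_abelianP _ abGY).
Qed.

Lemma cfMod_ker (mu : 'CF(G / M)) z : z \in M -> (mu %% M)%CF z = mu 1%g.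
Proof.
by move=> zM; rewrite -[z]mulg1 cfkerMl ?(subsetP (cfker_mod _ nMG)) // cfMod1.
Qed.

Lemma central_mul_val mu lam z : z \in Z ->
  central_mul (mu, lam) z = mu 1%g * (lam %% Y)%CF z.
Proof. by move=> zZ; rewrite cfunE cfMod_ker // (subsetP ZM). Qed.

(** G is the product of Y and Z. *)
Lemma mod_eq_on_central (lam lam' : 'CF(G / Y)) :
  {in Z, (lam %% Y)%CF =1 (lam' %% Y)%CF} -> lam = lam'.
Proof.
move=> e; apply: (can_inj (cfModK nYG)); apply/cfun_inP => g.
rewrite -{1}(sdprodW defG) => /mulsgP[y z yY zZ ->].
by rewrite !cfkerMl ?(subsetP (cfker_mod _ nYG)) // e.
Qed.

(** For surjectivity, phi is a multiple of a linear character nu on the central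
    subgroup Z.  Extend nu to lambda on G = Y Z trivially on Y; then phi / lambda is
    trivial on K and Z, hence on M. *)
Theorem central_mul_bijection :
  one_to_one [pred x : 'CF(G / M) * 'CF(G / Y) | Irr (G / M) x.1 && Irr_star (G / Y) x.2]
    (Irr_over G K Z) central_mul.
Proof.
split.
- move=> [mu lam] /= /andP[imu /andP[ilam lam1]].
  have mu1 : mu 1%g != 0 by have /irrP[i ->] := imu; apply: irr1_neq0.
  have Llam := mod_lin_char ilam.
  have irm : (mu %% M)%CF \in irr G by rewrite cfMod_irr.
  apply/and3P; split.
  + by rewrite /central_mul /= mulrC mul_lin_irr.
  + apply: subset_trans (cfker_mul _ _); rewrite subsetI.
    rewrite (subset_trans KM (cfker_mod _ nMG)).
    by rewrite (subset_trans KY (cfker_mod _ nYG)).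
  + apply: contra lam1 => /subsetP kZ; apply/eqP/mod_eq_on_central => z zZ.
    have := cfkerMl 1%g (kZ z zZ); rewrite mulg1.
    rewrite !central_mul_val ?group1 // => /(mulfI mu1) ->.
    by rewrite rmorph1 cfun1E (subsetP ZG) // lin_char1.
- move=> [mu lam] [mu' lam'] /= /andP[imu /andP[ilam _]] /andP[imu' /andP[ilam' _]] e.
  have mu1 : mu 1%g != 0 by have /irrP[i ->] := imu; apply: irr1_neq0.
  have Llam := mod_lin_char ilam; have Llam' := mod_lin_char ilam'.
  have val z : z \in Z -> mu 1%g * (lam %% Y)%CF z = mu' 1%g * (lam' %% Y)%CF z.
    move=> zZ; have := congr1 (fun f : 'CF(G) => f z) e.
    by rewrite !central_mul_val.
  have e1 : mu 1%g = mu' 1%g.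
    by have := val _ (group1 _); rewrite (lin_char1 Llam) (lin_char1 Llam') !mulr1.
  have {val}el : lam = lam'.
    by apply: mod_eq_on_central => z /val; rewrite -e1 => /(mulfI mu1).
  congr (_, _) => //; apply: (can_inj (cfModK nMG)); apply/cfun_inP => g gG.
  have := congr1 (fun f : 'CF(G) => f g) e; rewrite !cfunE /= -el.
  by apply: mulIf; apply: lin_char_neq0.
- move=> phi /and3P[/irrP[i ->] ki nZ].
  have zZ : Z \subset 'Z('chi_i)%CF by apply: comm_sub_cfcenter => //; apply: subset_trans ki.
  have [nu0 Lnu0 enu] := cfcenter_Res 'chi_i.
  pose nu := 'Res[Z] nu0; have Lnu : nu \is a linear_char by apply: cfRes_lin_char.
  have resZ z : z \in Z -> 'chi_i z = 'chi_i 1%g * nu z.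
    by move=> zin; rewrite -(cfResE _ (cfcenter_sub _) (subsetP zZ z zin)) enu !cfunE cfResE.
  pose lam := cfSdprod defG nu.
  have Llam : lam \is a linear_char by rewrite cfSdprod_lin_char.
  have kY : Y \subset cfker lam := cfker_sdprod defG nu.
  pose mu := lam^-1 * 'chi_i.
  have Llam' : lam^-1 \is a linear_char by rewrite invr_lin_char // cfConjC_lin_char.
  have irm : mu \in irr G by apply: mul_lin_irr; rewrite ?mem_irr.
  have emu : mu * lam = 'chi_i by rewrite mulrAC mulVr ?mul1r // lin_char_unitr.
  have kM : M \subset cfker mu.
    have [l el] := irrP irm.
    rewrite defM join_subG; apply/andP; split.
      apply: subset_trans (cfker_mul _ _); rewrite subsetI ki andbT.
      by rewrite invr_lin_char // cfker_aut (subset_trans KY).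
    apply/subsetP => z zin; rewrite /= el cfkerEirr inE -el !cfunE invr_lin_char // !cfunE.
    rewrite (lin_char1 Llam) rmorph1 mul1r (resZ z) // cfSdprodEr // mulrCA.
    by rewrite [X in _ * X]mulrC -normCK (normC_lin_char Lnu) // expr1n mulr1.
  exists ((mu / M)%CF, (lam / Y)%CF); last by rewrite /central_mul /= !cfQuoK.
  suff: [&& (mu / M)%CF \in irr (G / M), (lam / Y)%CF \in irr (G / Y) & (lam / Y)%CF != 1] by [].
  rewrite cfQuo_irr // irm cfQuo_irr // lin_char_irr //=.
  apply: contra nZ => /eqP l1; apply/subsetP => z zin; rewrite cfkerEirr inE resZ //.
  have l1' : lam = 1 by rewrite -(cfQuoK nYG kY) l1 rmorph1.
  by rewrite -(cfSdprodEr defG nu zin) -/lam l1' cfun1E (subsetP ZG) // mulr1.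
Qed.
End CentralProduct.

(** * Root supports *)

Lemma prec_sum (a b c g : posroot) : is_sum b g c -> prec c a -> prec b a.
Proof.
move=> /eqP e /precP[s es]; apply/precP; exists (g :: s).
by rewrite big_cons -es e opprD addrCA (addrCA (coef g)) subrr addr0.
Qed.

Lemma prec_refl a : prec a a.
Proof. by apply/precP; exists [::]; rewrite big_nil subrr. Qed.

Lemma kset_normal (a : posroot) : pattern_normal (kset a) [set: posroot].
Proof.
apply/pattern_normalP; split=> [|b g c]; first exact: subsetT.
by rewrite !inE => nb _ bgc; apply: contra nb; apply: prec_sum bgc.
Qed.

(** The root a is central modulo k(a). *)
Lemma kset_sum (a b c : posroot) : is_sum a b c -> c \in kset a.
Proof.
have chk : all (fun v : lattice => let: (m1, m2, m3, m4) := - v in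
  ~~ [&& 0 <= m1, 0 <= m2, 0 <= m3 & 0 <= m4]) pos_roots by vm_compute.
rewrite inE /prec => /eqP->; rewrite opprD addrA subrr add0r.
by apply: (allP chk); apply: mem_nth.
Qed.

Lemma prec_step (a g : posroot) : prec g a -> g != a ->
  exists b c, is_sum g b c /\ prec c a.
Proof.
pose precn i j := let: (m1, m2, m3, m4) := nth 0 pos_roots j - nth 0 pos_roots i in
  [&& 0 <= m1, 0 <= m2, 0 <= m3 & 0 <= m4].
have chk : all (fun a => all (fun g => (precn g a && (g != a)) ==>
    has (fun b => (root_add g b < 24)%N && precn (root_add g b) a) (iota 0 24))
  (iota 0 24)) (iota 0 24) by vm_compute.
move=> ga nga; have := allP (allP chk _ (posroot_iota a)) _ (posroot_iota g).
rewrite [precn g a]ga (nga : (g : nat) != a) => /hasP[b].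
rewrite mem_iota => b24 /andP[c24 ca].
by exists (Ordinal b24), (Ordinal c24); rewrite is_sumE; split; [apply: eqxx | apply: ca].
Qed.

Section RootSupport.
Variables (F : finFieldType) (gT : finGroupType) (x : posroot -> F -> gT).
Hypothesis xF : chevalley_family x.
Local Notation X := (root_group x).
Local Notation P := (pattern_group x).
Local Notation U := (P [set: posroot]).
Implicit Types (a b c d g z : posroot).

Lemma cfcenter_comm (G : {group gT}) (chi : 'CF(G)) y w : chi \is a character ->
  y \in ('Z(chi)%CF)%g -> w \in G -> [~ y, w]%g \in cfker chi.
Proof.
move=> Nchi yZ gG; have nK := normal_norm (cfker_normal chi).
have nZ : 'Z(chi)%CF%g \subset 'N(cfker chi).
  exact: subset_trans (cfcenter_sub _) nK.
have : [~: 'Z(chi)%CF, G]%g \subset cfker chi.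
  rewrite -quotient_cents2 //; apply: subset_trans (cfcenter_subset_center chi) _.
  by rewrite subIset // centsC subxx orbT.
by move/subsetP; apply; apply: mem_commg.
Qed.

(** If X_g is central modulo the kernel, then the kernel contains the commutators of
    X_g, hence X_(g+b) for all b with g + b a root; go up from g to a in this way. *)
Lemma center_root_below (i : Iirr U) a g : prec g a -> g != a ->
  X g \subset 'Z('chi_i)%CF -> X a \subset cfker 'chi_i.
Proof.
have [n] := ubnP (24 - g); elim: n g => // n IHn g hn ga nga gZ.
have [b [c [gbc ca]]] := prec_step ga nga.
have kc : X c \subset cfker 'chi_i.
  apply: (comm_root_sub xF (M := [group of cfker 'chi_i]) gbc) => s t.
  apply: cfcenter_comm; rewrite ?irr_char //; last by apply: mem_P; rewrite inE.
  by apply: (subsetP gZ); apply: mem_root_group.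
have [ec|nca] := eqVneq c a; first by rewrite -ec.
apply: IHn ca nca _; last exact: subset_trans kc (normal_sub (cfker_center_normal _)).
have /andP[gc _] := is_sum_lt gbc.
by rewrite -ltnS (leq_trans _ hn) // ltnS ltn_sub2l // (leq_trans gc) // ltnW.
Qed.

(** If k(a) were not in the kernel, take the last root b of k(a) with X_b not in the
    kernel: all commutators with X_b are in the kernel, so b is in the root support.
    Conversely, a is central modulo k(a), and the roots strictly below a are excluded
    by [center_root_below]. *)
Theorem root_support_singleton (i : Iirr U) a :
  ([set g | (X g \subset 'Z('chi_i)%CF) && ~~ (X g \subset cfker 'chi_i)] == [set a])
  = (P (kset a) \subset cfker 'chi_i) && ~~ (X a \subset cfker 'chi_i).
Proof.
apply/eqP/andP => [rs|[ka nka]].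
  have na : a \in [set g | (X g \subset 'Z('chi_i)%CF) && ~~ (X g \subset cfker 'chi_i)].
    by rewrite rs set11.
  move: na; rewrite inE => /andP[_ ->]; split=> //.
  suff h b : b \in kset a -> X b \subset cfker 'chi_i.
    by apply: (P_subset (G := [group of cfker 'chi_i])) => b t /h/subsetP; apply;
      apply: mem_root_group.
  have [n] := ubnP (24 - b); elim: n b => // n IHn b hn kb.
  pose N := [set c in kset a | (b < c)%N].
  have nN : pattern_normal N [set: posroot].
    have [_ hk] := pattern_normalP _ _ (kset_normal a).
    apply/pattern_normalP; split=> [|c d e]; first exact: subsetT.
    rewrite ![_ \in N]in_set => /andP[ck bc] dT cde; have /andP[ce _] := is_sum_lt cde.
    by rewrite (hk c d e ck dT cde) (ltn_trans bc).
  have kN : P N \subset cfker 'chi_i.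
    apply: (P_subset (G := [group of cfker 'chi_i])) => c t; rewrite in_set => /andP[ck bc].
    apply: (subsetP (IHn c _ ck)); last exact: mem_root_group.
    by rewrite -ltnS (leq_trans _ hn) // ltnS ltn_sub2l // (leq_trans bc) // ltnW.
  apply: contraTT (kb) => nb; have : b \in [set a]; last by move/set1P->; rewrite inE prec_refl.
  rewrite -rs inE nb andbT -(P_set1 xF); apply: comm_sub_cfcenter.
    by apply: P_mono; apply: subsetT.
  apply: subset_trans kN; apply: (P_comm_sub xF nN); rewrite ?subsetT //.
  move=> _ c d /set1P-> _ bcd; have [_ hk] := pattern_normalP _ _ (kset_normal a).
  by rewrite in_set (hk b c d kb (in_setT c) bcd) /=; case/andP: (is_sum_lt bcd).
apply/setP => g; rewrite !inE; apply/andP/eqP => [[gZ ng]|->]; last first.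
  split=> //; rewrite -(P_set1 xF); apply: comm_sub_cfcenter.
    by apply: P_mono; apply: subsetT.
  apply: subset_trans ka; apply: (P_comm_sub xF (kset_normal a)); rewrite ?subsetT //.
  by move=> _ c d /set1P-> _; apply: kset_sum.
apply/eqP; apply: contraNT nka => nga; apply: center_root_below nga gZ.
apply: contraNT ng => nga; apply: subset_trans ka.
by apply: sub_P; rewrite inE.
Qed.
End RootSupport.

(** * Characters of minimal degree *)

Section MinimalDegree.
Variables (gT : finGroupType) (U G M Y : {group gT}) (q d : nat) (E : pred 'CF(U)).
Hypotheses (GU : G \subset U) (nMG : M <| G) (nYG : Y <| G).
Hypotheses (abGY : abelian (G / Y)) (ntGY : (1 < #|(G / Y)%g|)%N).
Hypotheses (q_gt1 : (1 < q)%N) (indexG : #|U : G| = (q ^ d)%N).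

Definition induced_mul (x : 'CF(G / M) * 'CF(G / Y)) : 'CF(U) := 'Ind[U] (central_mul x).

Local Notation D := [pred x : 'CF(G / M) * 'CF(G / Y) |
  Irr (G / M)%G x.1 && Irr_star (G / Y)%G x.2].
Local Notation Dlin := [pred x : 'CF(G / M) * 'CF(G / Y) |
  Irr_lin (G / M)%G x.1 && Irr_star (G / Y)%G x.2].

Definition minimal_degree : pred 'CF(U) :=
  [pred chi | E chi && all (fun psi : 'CF(U) => E psi ==> (chi 1%g <= psi 1%g)) (irr U)].

Hypothesis E_irr : forall chi, E chi -> chi \in irr U.
Hypothesis into : forall x, D x -> E (induced_mul x).
Hypothesis inj : forall x y, D x -> D y -> induced_mul x = induced_mul y -> x = y.
Hypothesis cover : forall chi, E chi ->
  (exists2 x, D x & induced_mul x = chi) \/ (q ^ d.+1)%:R <= chi 1%g.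

Let DE mu lam : D (mu, lam) =
  [&& mu \in irr (G / M), lam \in irr (G / Y) & lam != 1] := erefl.

Let DlinE mu lam : Dlin (mu, lam) =
  [&& mu \in irr (G / M) & mu 1%g == 1] && [&& lam \in irr (G / Y) & lam != 1] := erefl.

Let Dlin_D x : Dlin x -> D x.
Proof. by case: x => mu lam; rewrite DlinE DE => /andP[/andP[-> _] ->]. Qed.

Let qd_gt0 : 0 < (q ^ d)%:R :> algC.
Proof. by rewrite ltr0n expn_gt0 (ltn_trans _ q_gt1). Qed.

Lemma induced_mul1 x : D x -> induced_mul x 1%g = (q ^ d)%:R * x.1 1%g.
Proof.
case: x => mu lam; rewrite DE => /and3P[_ /irrP[i ->] _].
rewrite cfInd1 // indexG cfunE !cfMod1 (lin_char1 (char_abelianP _ abGY i)).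
by rewrite mulr1.
Qed.

Lemma nontrivial_irr : exists2 lam : 'CF(G / Y), lam \in irr (G / Y) & lam != 1.
Proof.
have : (1 < #|Iirr (G / Y)|)%N by rewrite card_Iirr_abelian.
rewrite (cardD1 0) inE /= => /(leq_trans (isT : (0 < 1)%N)) /= h.
have /card_gt0P[k] : (0 < #|[predD1 Iirr (G / Y) & 0%R]|)%N by rewrite -ltnS.
rewrite !inE andbT => k0; exists 'chi_k; rewrite ?mem_irr //.
by rewrite -irr0 (inj_eq irr_inj).
Qed.

(** The degree of the image of (mu, lambda) is q^d mu(1), and the characters outside
    the image have a larger degree. *)
Lemma minimal_degreeP chi : reflect (exists2 x, Dlin x & induced_mul x = chi)
  (minimal_degree chi).
Proof.
apply: (iffP andP) => [[Ec /allP minc]|[[mu lam] Dl <-]].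
  have [lam0 ilam0 nlam0] := nontrivial_irr.
  have D0 : D (1, lam0) by rewrite DE ilam0 nlam0 cfun1_irr.
  have c1 : chi 1%g <= (q ^ d)%:R.
    have := minc _ (E_irr (into D0)); rewrite (into D0) implyTb.
    by rewrite induced_mul1 // cfun11 mulr1.
  case: (cover Ec) => [[[mu lam] Dx ex]|big]; last first.
    by have := le_trans big c1; rewrite ler_nat leq_exp2l // ltnn.
  exists (mu, lam) => //; move: (Dx); rewrite DE DlinE => /and3P[imu -> ->].
  rewrite imu /= andbT eq_le irr1_ge1 // andbT.
  by move: c1; rewrite -ex induced_mul1 // ger_pMr.
have Dx := Dlin_D Dl; move: Dl; rewrite DlinE => /andP[/andP[_ /eqP mu1] _].
split; first exact: into.
apply/allP => psi _; apply/implyP => Ep; rewrite induced_mul1 // mu1 mulr1.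
case: (cover Ep) => [[[mu' lam'] Dx' <-]|big].
  rewrite induced_mul1 // ler_pMr // irr1_ge1 //.
  by move: Dx'; rewrite DE => /and3P[].
by apply: le_trans big; rewrite ler_nat leq_exp2l.
Qed.

Theorem minimal_degree_bijection : one_to_one Dlin minimal_degree induced_mul.
Proof.
split=> [x Dx|x y /Dlin_D Dx /Dlin_D Dy|z /minimal_degreeP[x Dx <-]].
- by apply/minimal_degreeP; exists x.
- exact: inj.
- by exists x.
Qed.

Theorem minimal_degree1 chi : minimal_degree chi -> chi 1%g = (q ^ d)%:R.
Proof.
case/minimal_degreeP=> -[mu lam] Dl <-; rewrite (induced_mul1 (Dlin_D Dl)).
by move: Dl; rewrite DlinE => /andP[/andP[_ /eqP ->] _]; rewrite mulr1.
Qed.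

(** The number of linear characters is the order of the abelianization. *)
Theorem card_minimal_degree : #|[set i : Iirr U | minimal_degree 'chi_i]| =
  (#|(G / M)%g : (G / M)^`(1)%g| * (#|(G / Y)%g| - 1))%N.
Proof.
pose A := [set jk : Iirr (G / M) * Iirr (G / Y) |
  ('chi_(jk.1) \is a linear_char) && (jk.2 != 0)].
pose f (jk : Iirr (G / M) * Iirr (G / Y)) := cfIirr (induced_mul ('chi_(jk.1), 'chi_(jk.2))).
have DA jk : (jk \in A) = Dlin ('chi_(jk.1), 'chi_(jk.2)).
  rewrite in_set DlinE !mem_irr qualifE /= irr_char /=; congr (_ && _).
  by rewrite -irr0 (inj_eq irr_inj).
have fE jk : jk \in A -> 'chi_(f jk) = induced_mul ('chi_(jk.1), 'chi_(jk.2)).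
  by rewrite DA => /Dlin_D Djk; rewrite cfIirrE // E_irr // into.
have -> : [set i : Iirr U | minimal_degree 'chi_i] = f @: A.
  apply/setP => i; rewrite inE; apply/minimal_degreeP/imsetP.
    case=> -[mu lam] Dx ex; move: (Dx) ex.
    rewrite DlinE => /andP[/andP[/irrP[j ej] _] /andP[/irrP[k ek] _]].
    rewrite ej ek in Dx * => ex; exists (j, k); first by rewrite DA.
    by apply: irr_inj; rewrite fE ?DA.
  by case=> jk Ajk ->; exists ('chi_(jk.1), 'chi_(jk.2)); rewrite -?DA ?fE.
rewrite card_in_imset => [|[j k] [j' k'] Aj Aj' e]; last first.
  have := congr1 (fun i => 'chi_i) e; rewrite !fE // => /inj.
  move: Aj Aj'; rewrite !DA => /Dlin_D Dj /Dlin_D Dj'.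
  by move=> /(_ Dj Dj')[/irr_inj-> /irr_inj->].
rewrite -card_lin_irr -(card_Iirr_abelian abGY).
have -> : A = setX [set j | 'chi_j \is a linear_char] [set~ 0].
  by apply/setP => -[j k]; rewrite !inE.
by rewrite cardsX cardsC1 cardsE subn1.
Qed.
End MinimalDegree.

(** * The arms, legs and sources of F4 *)

Definition all_indices : seq nat := iota 0 24.

Definition precn (i j : nat) : bool :=
  let: (m1, m2, m3, m4) := nth 0 pos_roots j - nth 0 pos_roots i in
  [&& 0 <= m1, 0 <= m2, 0 <= m3 & 0 <= m4].

Definition kset_list (a : nat) : seq nat := [seq b <- all_indices | ~~ precn b a].

Definition root_sub (i j : nat) : nat :=
  index (nth 0 pos_roots i - nth 0 pos_roots j) pos_roots.
Arguments root_sub : simpl never.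

Definition arm_pairs (a : nat) : seq (nat * nat) :=
  [seq (j.-1, root_sub a j.-1) | j <- nth [::] arm_table a].

(** The roots 15, respectively 20 and 17, that the normal closure adds to the leg of
    alpha_20, respectively alpha_22 (numbered from 0 here). *)
Definition closure_extra (a : nat) : seq nat :=
  if a == 19%N then [:: 14%N] else if a == 21%N then [:: 19%N; 16%N] else [::].

Definition source_list (a : nat) := peel_source all_indices (arm_pairs a).
Definition kernel_list (a : nat) := closure_extra a ++ peel_kernel (kset_list a) (arm_pairs a).

Lemma mem_all_indices (a : posroot) : (a : nat) \in all_indices.
Proof. exact: posroot_iota. Qed.

Lemma pat_all : pat all_indices = [set: posroot].
Proof. by apply/setP => b; rewrite inE in_setT mem_all_indices. Qed.

Lemma pat_kset (a : posroot) : pat (kset_list a) = kset a.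
Proof. by apply/setP => b; rewrite !in_set mem_filter mem_all_indices andbT. Qed.

Lemma mem_peel_source (S : seq nat) l b :
  (b \in peel_source S l) = (b \in S) && (b \notin map fst l).
Proof.
elim: l S => [|p l IHl] S /=; first by rewrite andbT.
by rewrite IHl mem_filter inE negb_or andbCA andbA.
Qed.

Lemma mem_peel_kernel (K : seq nat) l b :
  (b \in peel_kernel K l) = (b \in K) || (b \in map snd l).
Proof.
elim: l K => [|p l IHl] K /=; first by rewrite orbF.
by rewrite IHl !inE orbCA orbA.
Qed.

Lemma mem_arm_list (a : posroot) (b : nat) :
  (b \in [seq j.-1 | j <- nth [::] arm_table a]) = (b.+1 \in nth [::] arm_table a).
Proof.
have chk : all (fun t => all (fun j => 0 < j)%N t) arm_table by vm_compute.
have /allP pos : all (fun j => 0 < j)%N (nth [::] arm_table a).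
  by apply: (allP chk); apply: mem_nth; rewrite ltn_ord.
apply/mapP/idP => [[j jin ->]|h]; last by exists b.+1.
by rewrite prednK ?pos.
Qed.

Lemma pat_source (a : posroot) : pat (source_list a) = source a.
Proof.
apply/setP => b; rewrite inE mem_peel_source mem_all_indices /= in_setC inE.
by rewrite -map_comp mem_arm_list.
Qed.

Lemma pat_leg_kset (a : posroot) :
  pat (peel_kernel (kset_list a) (arm_pairs a)) = leg a :|: kset a.
Proof.
apply/setP => b; rewrite in_set mem_peel_kernel in_setU orbC -pat_kset.
congr (_ || _); last by rewrite in_set.
rewrite in_set -map_comp; apply/mapP/exists_inP.
  case=> j jin /=; rewrite /root_sub => eb; have j24 : (j.-1 < 24)%N.
    have /allP chk : all (fun t => all (fun j => j.-1 < 24)%N t) arm_table by vm_compute.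
    by apply: (allP (chk _ _)) jin; apply: mem_nth; rewrite ltn_ord.
  exists (Ordinal j24).
    by rewrite in_set -mem_arm_list; apply/mapP; exists j.
  by apply/eqP; rewrite {1}/coef eb nth_index // -index_mem -eb ltn_ord.
case=> g; rewrite in_set => gin /eqP e; exists g.+1 => //=.
by rewrite /root_sub -[(nth _ _ a - _)%R]e /coef index_uniq ?ltn_ord.
Qed.

Lemma normal_closureE (M S Q : {set posroot}) : pattern_normal Q S -> M \subset Q ->
  (forall N, pattern_normal N S -> M \subset N -> Q \subset N) -> normal_closure M S = Q.
Proof.
move=> nQ MQ minQ; apply/eqP; rewrite eqEsubset; apply/andP; split.
  by apply: bigcap_inf; rewrite nQ.
by apply/bigcapsP => N /andP[nN MN]; apply: minQ.
Qed.

(** The pattern that together with a is divided out of the source. *)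
Definition reduced_kernel (a : posroot) : {set posroot} :=
  (if a \in R4normal then leg a else legbar a) :|: kset a.

Lemma kernel_check : all (fun a =>
  [&& all (mem (source_list a)) (kernel_list a),
      absorbs (kernel_list a) (source_list a) (kernel_list a),
      a \notin kernel_list a &
      all (fun e => has (fun i => has (fun j => root_add i j == e) (source_list a))
        (peel_kernel (kset_list a) (arm_pairs a))) (closure_extra a)]) all_indices.
Proof. by vm_compute. Qed.

Lemma kernelP (a : posroot) : [/\ pattern_normal (pat (kernel_list a)) (source a),
  a \notin pat (kernel_list a) & pat (kernel_list a) = reduced_kernel a].
Proof.
have /and4P[sub abs na ext] := allP kernel_check a (mem_all_indices a).
have nN : pattern_normal (pat (kernel_list a)) (source a).
  by rewrite -pat_source; apply: pat_normal.
split=> //; first by rewrite in_set.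
have split_pat : pat (kernel_list a) = pat (closure_extra a) :|: (leg a :|: kset a).
  by apply/setP => b; rewrite -pat_leg_kset !in_set mem_cat.
have exE : a \in R4normal -> closure_extra a = [::].
  by rewrite in_set !inE !eqSS negb_or /closure_extra => /andP[/negPf-> /negPf->].
rewrite /reduced_kernel; case: ifPn => [aR|naR].
  by rewrite split_pat exE //; apply/setP => b; rewrite !in_set.
rewrite /legbar (@normal_closureE _ _ (pat (kernel_list a))) //.
- apply/setP => b; rewrite in_setU in_setD split_pat !in_setU.
  by case: (b \in kset a); rewrite ?orbT ?orbF.
- by rewrite split_pat subsetUr.
move=> N /pattern_normalP[_ hN] MN; rewrite split_pat subUset MN andbT.
apply/subsetP => e; rewrite in_set => /(allP ext)/hasP[i iM /hasP[j jS /eqP eij]].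
have lt24 k : k \in source_list a -> (k < 24)%N.
  by rewrite mem_peel_source mem_iota => /andP[].
have i24 : (i < 24)%N by apply/lt24/(allP sub); rewrite mem_cat iM orbT.
apply: (hN (Ordinal i24) (Ordinal (lt24 j jS))); last by rewrite is_sumE; apply/eqP.
  by apply: (subsetP MN); rewrite -pat_leg_kset in_set.
by rewrite -pat_source in_set.
Qed.

Lemma peel_check : all (fun a => (a \in [:: 19; 21]%N) ||
  peelable a all_indices (kset_list a) (arm_pairs a)) all_indices.
Proof. by vm_compute. Qed.

Lemma card_pat (l : seq nat) : uniq l -> all (fun i => i < 24)%N l -> #|pat l| = size l.
Proof.
move=> ul /allP l24; rewrite cardE -(size_map val); apply: perm_size.
apply: uniq_perm; rewrite ?(map_inj_uniq val_inj) ?enum_uniq // => i.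
apply/mapP/idP => [[b]|il]; first by rewrite mem_enum in_set => bl ->.
by exists (Ordinal (l24 i il)); rewrite // mem_enum in_set.
Qed.

Lemma mem_source (a : posroot) : a \in source a.
Proof.
rewrite in_setC; apply/negP => /(subsetP (arm_hook a)).
by rewrite in_setD1 eqxx.
Qed.

(** The arm contains one of any two roots with sum a. *)
Lemma source_setD1_normal (a : posroot) : pattern_normal (source a :\ a) (source a).
Proof.
have := source_closed a; rewrite closed_normal => /pattern_normalP[_ cl].
apply/pattern_normalP; split=> [|b g c]; first exact: subD1set.
rewrite !in_setD1 => /andP[_ bS] gS bgc; rewrite (cl b g) // andbT.
apply/eqP => ca; have := arm_leg (a := a) (b := b) (g := g); rewrite -ca => /(_ bgc).
by move: bS gS; rewrite !in_setC ca => /negPf-> /negPf->.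
Qed.

Lemma kset_reduced (a : posroot) : kset a \subset reduced_kernel a.
Proof. exact: subsetUr. Qed.

Lemma reduced_kernel_normal a : pattern_normal (reduced_kernel a) (source a).
Proof. by have [h _ <-] := kernelP a. Qed.

Lemma reduced_kernel_sub a : reduced_kernel a \subset source a :\ a.
Proof.
have [h na e] := kernelP a; rewrite -e subsetD1 na andbT.
by have [] := pattern_normalP _ _ h.
Qed.

Lemma full_kernel_normal a : pattern_normal (reduced_kernel a :|: [set a]) (source a).
Proof.
have [NS hN] := pattern_normalP _ _ (reduced_kernel_normal a).
apply/pattern_normalP; split=> [|b g c]; first by rewrite subUset NS sub1set mem_source.
rewrite in_setU => /orP[bN gS bgc|/set1P-> _ agc]; rewrite in_setU; first by rewrite (hN b g).
by rewrite (subsetP (kset_reduced a)) // (kset_sum agc).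
Qed.

Lemma mida_check : all (fun a =>
  let sums := [seq root_add i j | i <- source_list a, j <- source_list a] in
  [&& size [seq b <- source_list a | [&& b != a, b \notin kernel_list a & b \notin sums]]
      == (nth (0, 0) mida_table a).1, uniq [seq j.-1 | j <- nth [::] arm_table a],
      all (fun j => j < 24)%N [seq j.-1 | j <- nth [::] arm_table a] &
      size (nth [::] arm_table a) == (nth (0, 0) mida_table a).2])%N all_indices.
Proof. by vm_compute. Qed.

Lemma card_arm (a : posroot) : #|arm a| = (nth (0, 0) mida_table a).2%N.
Proof.
have /and4P[_ u l24 /eqP<-] := allP mida_check a (mem_all_indices a).
rewrite -(size_map (fun j => j.-1)) -card_pat //; apply: eq_card => b.
by rewrite !in_set mem_arm_list.
Qed.

Lemma card_source_abelianization (a : posroot) :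
  (#|source a| - #|(reduced_kernel a :|: [set a]) :|: root_sums (source a)|
   = (nth (0, 0) mida_table a).1)%N.
Proof.
have /and4P[/eqP<- _ _ _] := allP mida_check a (mem_all_indices a).
have [_ _ e] := kernelP a.
have [NS _] := pattern_normalP _ _ (full_kernel_normal a).
have := source_closed a; rewrite closed_normal => /pattern_normalP[_ cl].
move: (reduced_kernel a) e NS => R e NS.
rewrite -cardsDS; last first.
  rewrite subUset NS; apply/subsetP => c /root_sumsP[b [g [bS gS bgc]]]; exact: cl bgc.
rewrite -card_pat.
- apply: eq_card => b; rewrite in_setD !in_setU in_set1 [b \in pat _]in_set mem_filter.
  have -> : (b \in R) = ((b : nat) \in kernel_list a) by rewrite -e in_set.
  have -> : (b \in source a) = ((b : nat) \in source_list a) by rewrite -pat_source in_set.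
  rewrite (_ : (b \in root_sums (source a)) =
    ((b : nat) \in [seq root_add i j | i <- source_list a, j <- source_list a])).
    rewrite -(inj_eq val_inj) /=; case: (_ \in kernel_list a); case: (_ == _ :> nat) => //=.
  apply/root_sumsP/allpairsP.
    case=> [g [h [gS hS]]]; rewrite is_sumE => /eqP ghb; exists (g : nat, h : nat).
    by move: gS hS; rewrite -pat_source !in_set => gS hS; split; rewrite //= ghb.
  case=> -[i j] /= [iS jS eb].
  have lt24 k : k \in source_list a -> (k < 24)%N.
    by rewrite mem_peel_source mem_iota => /andP[].
  exists (Ordinal (lt24 i iS)), (Ordinal (lt24 j jS)).
  by rewrite is_sumE -eb -pat_source !in_set.
- rewrite filter_uniq // /source_list.
  have : uniq all_indices by [].
  elim: (arm_pairs a) all_indices => //= p l IHl S uS.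
  by apply: IHl; rewrite filter_uniq.
- by apply/allP => i; rewrite mem_filter mem_peel_source mem_iota => /andP[_ /andP[]].
Qed.

(** * Induction from the source *)

Section Coverage.
Variables (F : finFieldType) (gT : finGroupType) (x : posroot -> F -> gT).
Hypothesis xF : chevalley_family x.
Local Notation P := (pattern_group x).
Local Notation q := #|F|.
Implicit Types (a b c d g z : posroot) (S K T N : {set posroot}).

Let F0 : (0 < q)%N. Proof. by apply/card_gt0P; exists 0. Qed.

(** Weaker than a bijection by what the two exceptional roots require: characters of
    large degree may be missed. *)
Definition covers S N T K z (e : nat) : Prop :=
  [/\ forall phi, Irr_pattern x S N z phi -> Irr_pattern x T K z ('Ind[P T] phi),
      {in Irr_pattern x S N z &, injective 'Ind[P T, P S]} &
      forall chi, Irr_pattern x T K z chi ->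
        (exists2 phi, Irr_pattern x S N z phi & 'Ind[P T] phi = chi)
        \/ (q ^ e)%:R <= chi 1%g].

Lemma bijection_covers S N T K z e :
  one_to_one (Irr_pattern x S N z) (Irr_pattern x T K z) 'Ind[P T] -> covers S N T K z e.
Proof.
by case=> h1 h2 h3; split; [apply: h1 | apply: h2 | move=> chi /h3; left].
Qed.

Lemma covers_split S N T K b z e : covers S N T (K :|: [set b]) z e ->
  (forall chi, Irr_pattern x T K z chi -> ~~ (P [set b] \subset cfker chi) ->
     (q ^ e)%:R <= chi 1%g) ->
  covers S N T K z e.
Proof.
case=> h1 h2 h3 hb; split=> // [phi /h1|chi ochi].
  by rewrite Irr_pattern_setU => /andP[].
have [kb|nkb] := boolP (P [set b] \subset cfker chi); last by right; apply: hb.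
by apply: h3; rewrite Irr_pattern_setU kb.
Qed.

Lemma covers_comp S N T K T' K' z e m : covers S N T K z e -> S \subset T -> T \subset T' ->
  one_to_one (Irr_pattern x T K z) (Irr_pattern x T' K' z) 'Ind[P T'] ->
  #|P T' : P T| = (q ^ m)%N -> covers S N T' K' z (m + e).
Proof.
case=> h1 h2 h3 ST TT' [g1 g2 g3] eq_m.
have II phi : 'Ind[P T'] ('Ind[P T, P S] phi) = 'Ind[P T'] phi.
  by rewrite cfIndInd ?P_mono.
split=> [phi /h1/g1|phi psi hphi hpsi|chi /g3[theta ot <-]]; rewrite -?II //.
- by move=> /g2 e'; apply: h2 => //; apply: e'; apply: h1.
- case: (h3 _ ot) => [[phi ophi <-]|big]; [left; exists phi => //; by rewrite II | right].
  by rewrite cfInd1 ?P_mono // eq_m expnD natrM ler_pM2l // ltr0n expn_gt0 F0.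
Qed.

Lemma peel_degree z (S K : seq nat) l chi : closed_pattern (pat S) -> peelable z S K l ->
  Irr_pattern x (pat S) (pat K) z chi -> (q ^ size l)%:R <= chi 1%g.
Proof.
move=> clS hl och; have [_ _ /(_ _ och)[phi op <-]] := peel_bijection xF hl.
rewrite cfInd1 ?P_mono ?peel_sub // (peel_index xF clS hl).
by rewrite ler_pMr ?ltr0n ?expn_gt0 ?F0 // irr1_ge1 //; case/and3P: op.
Qed.

(** Some constituent of the restriction to P(S) does not have X_z in its kernel. *)
Lemma restrict_degree S T K z chi (B : algC) : S \subset T -> K \subset S -> z \in S ->
  (forall theta, Irr_pattern x S K z theta -> B <= theta 1%g) ->
  Irr_pattern x T K z chi -> B <= chi 1%g.
Proof.
move=> ST KS zS hB /and3P[/irrP[i ->] ki nz].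
have PST := P_mono x ST; have Nres := cfRes_char (P S) (irr_char i).
have kRes : cfker ('Res[P S] 'chi_i) = P S :&: cfker 'chi_i by rewrite cfker_Res ?irr_char.
have [j ij nzj] : exists2 j, j \in irr_constt ('Res[P S] 'chi_i)
    & ~~ (P [set z] \subset cfker 'chi_j).
  apply/exists_inP; apply: contraNT nz => /exists_inPn h.
  have : P [set z] \subset cfker ('Res[P S] 'chi_i).
    rewrite cfkerE // subsetI P_mono ?sub1set //=; apply/bigcapsP => j /h.
    by rewrite negbK.
  by rewrite kRes subsetI => /andP[].
have oj : Irr_pattern x S K z 'chi_j.
  apply/and3P; split=> //; first exact: mem_irr.
  by apply: subset_trans (cfker_constt Nres ij); rewrite kRes subsetI P_mono.
apply: le_trans (hB _ oj) _.
by have := char1_ge_constt Nres ij; rewrite cfRes1.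
Qed.

Lemma pat_sub (S T : seq nat) : all (mem T) S -> pat S \subset pat T.
Proof. by move=> /allP ST; apply/subsetP => b; rewrite !in_set => /ST. Qed.

Lemma eq_pat (S T : seq nat) : perm_eq S T -> pat S = pat T.
Proof. by move/perm_mem=> e; apply/setP => b; rewrite !in_set e. Qed.

Lemma pat_closed (S : seq nat) : absorbs S S S -> closed_pattern (pat S).
Proof. by move=> h; rewrite closed_normal pat_normal //; apply/allP. Qed.

Lemma normal_root_bijection a : a \in R4normal ->
  one_to_one (Irr_pattern x (source a) (reduced_kernel a) a)
    (Irr_pattern x [set: posroot] (kset a) a) 'Ind[P [set: posroot]].
Proof.
move=> aR; rewrite /reduced_kernel aR.
have pl : peelable a all_indices (kset_list a) (arm_pairs a).
  have := allP peel_check a (mem_all_indices a).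
  by move: aR; rewrite in_set !inE !eqSS => /negPf->.
have := peel_bijection xF pl.
by rewrite pat_all pat_kset pat_leg_kset -/(source_list a) pat_source.
Qed.

Lemma covers_peel (z : posroot) (S1 N1 : {set posroot}) (S K : seq nat) l e :
  closed_pattern (pat S) -> peelable z S K l ->
  S1 \subset pat (peel_source S l) ->
  covers S1 N1 (pat (peel_source S l)) (pat (peel_kernel K l)) z e ->
  covers S1 N1 (pat S) (pat K) z (size l + e).
Proof.
move=> clS pl sub cov.
apply: (covers_comp cov sub (peel_sub S l) (peel_bijection xF pl)).
by rewrite -(peel_index xF clS pl).
Qed.

(** If the central root b is in the kernel of a character the pairs l can be removed,
    and otherwise the pairs l' with respect to b bound the degree from below. *)
Lemma covers_branch (z b : posroot) (S K : seq nat) (l l' : seq (nat * nat)) :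
  closed_pattern (pat S) -> peelable z S ((b : nat) :: K) l -> peelable b S K l' ->
  covers (pat (peel_source S l)) (pat (peel_kernel ((b : nat) :: K) l)) (pat S) (pat K) z
    (size l').
Proof.
move=> clS pl pl'; apply: (@covers_split _ _ _ _ b).
  by apply: bijection_covers; rewrite -pat_cons; apply: (peel_bijection xF pl).
by move=> chi /and3P[h1 h2 _] h3; apply: (peel_degree (z := b) clS pl'); apply/and3P.
Qed.

(** If b is not in the kernel, the bound comes from a constituent of the restriction
    to the pattern R. *)
Lemma covers_restrict (z b : posroot) (S1 N1 : {set posroot}) (R S K : seq nat) l :
  [&& absorbs R R R, all (mem S) R, all (mem R) K & (b : nat) \in R] ->
  peelable b R K l ->
  covers S1 N1 (pat S) (pat ((b : nat) :: K)) z (size l) ->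
  covers S1 N1 (pat S) (pat K) z (size l).
Proof.
case/and4P=> /pat_closed clR /pat_sub RS /pat_sub KR bR pl.
rewrite pat_cons => /covers_split; apply=> chi /and3P[h1 h2 _] h3.
apply: (@restrict_degree _ _ (pat K) b _ _ RS KR); first by rewrite in_set.
  by move=> theta; apply: (peel_degree (z := b) clR pl).
by apply/and3P.
Qed.

(** After the removal of the arm roots 4, 2 and 5, the root 15 is central modulo the
    kernel.  If X_15 is in the kernel of a character, the pair (10, 12) can be removed;
    if not, then (1, 13) and (8, 7) can be removed with respect to 15, and the degree
    is at least q^(3+2).  The lists below number the roots from 0. *)
Lemma alpha20_check : let l := [:: (3, 16); (1, 17); (4, 15)]%N in
  let S := peel_source all_indices l in let K := peel_kernel (kset_list 19) l in
  let l' := [:: (9, 11)]%N in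
  [/\ absorbs all_indices all_indices all_indices && absorbs S S S,
    peelable 19 all_indices (kset_list 19) l,
    peelable 19 S (14%N :: K) l', peelable 14 S K [:: (0, 12); (7, 6)]%N &
    perm_eq (source_list 19) (peel_source S l')
      && perm_eq (kernel_list 19) (peel_kernel (14%N :: K) l')].
Proof. by split; vm_compute. Qed.

Lemma covers_alpha20 (a : posroot) : a = 19%N :> nat ->
  covers (source a) (reduced_kernel a) [set: posroot] (kset a) a 5.
Proof.
move=> ea; have [_ _ <-] := kernelP a; rewrite -pat_source -pat_kset -pat_all ea.
have [/andP[/pat_closed cl0 /pat_closed cl1] p1 p2 p3 /andP[eS eK]] := alpha20_check.
rewrite (eq_pat eS) (eq_pat eK).
have b15 : (14 < 24)%N by [].
move: p1 p2; rewrite -{1 3}ea => p1 p2.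
exact: covers_peel cl0 p1 (peel_sub _ _) (covers_branch (b := Ordinal b15) cl1 p2 p3).
Qed.

(** After the removal of 3 and 7, the root 20 is central modulo the kernel.  If X_20
    is not in the kernel, restrict to the pattern without 9 and 11, where four pairs
    with sum 20 can be removed, so that the degree is at least q^(2+4).  Otherwise
    remove 9 and 11; now 17 is central, and if X_17 is not in the kernel, then the
    pairs (4, 14) and (6, 12) give the degree q^(4+2).  If it is in the kernel, the
    last pair (13, 15) can be removed. *)
Lemma alpha22_check :
  let l1 := [:: (2, 20); (6, 18)]%N in let l2 := [:: (8, 17); (10, 15)]%N in
  let S := peel_source all_indices l1 in let K := peel_kernel (kset_list 21) l1 in
  let T := peel_source S l2 in let M := peel_kernel (19%N :: K) l2 in
  let R := remove (remove S 8) 10 in let l3 := [:: (12, 14)]%N in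
  [/\ [/\ absorbs all_indices all_indices all_indices, absorbs S S S & absorbs T T T],
    peelable 21 all_indices (kset_list 21) l1 /\ peelable 21 S (19%N :: K) l2,
    [&& absorbs R R R, all (mem S) R, all (mem R) K & 19%N \in R] /\
      peelable 19 R K [:: (3, 16); (1, 17); (4, 15); (9, 11)]%N,
    peelable 21 T (16%N :: M) l3 /\ peelable 16 T M [:: (3, 13); (5, 11)]%N &
    perm_eq (source_list 21) (peel_source T l3)
      && perm_eq (kernel_list 21) (peel_kernel (16%N :: M) l3)].
Proof. by repeat split; vm_compute. Qed.

Lemma covers_alpha22 (a : posroot) : a = 21%N :> nat ->
  covers (source a) (reduced_kernel a) [set: posroot] (kset a) a 6.
Proof.
move=> ea; have [_ _ <-] := kernelP a; rewrite -pat_source -pat_kset -pat_all ea.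
have [[/pat_closed cl0 /pat_closed cl1 /pat_closed cl2] [p1 p2] [r3 p3] [p4 p5]] := alpha22_check.
case/andP=> eS eK; rewrite (eq_pat eS) (eq_pat eK).
have b20 : (19 < 24)%N by []; have c17 : (16 < 24)%N by [].
move: p1 p2 p4; rewrite -{1 3 5}ea => p1 p2 p4.
have cov := covers_branch (b := Ordinal c17) cl2 p4 p5.
have {}cov := covers_peel cl1 p2 (peel_sub _ _) cov.
have {}cov := covers_restrict (b := Ordinal b20) r3 p3 cov.
exact: covers_peel cl0 p1 (subset_trans (peel_sub _ _) (peel_sub _ _)) cov.
Qed.
End Coverage.

(** * The correspondence for UF4 *)

Lemma odd_card_two_neq0 (F : finFieldType) : odd #|F| -> 2%:R != 0 :> F.
Proof.
move=> oF; apply/eqP => two0.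
have : (1 : F) *+ #|F| = 0.
  by have := expg_cardG (in_setT (1 : F)); rewrite cardsT FinRing.zmodXgE.
rewrite -(odd_double_half #|F|) oF mulrnDr -mul2n mulrnA two0 mul0rn addr0.
by move/eqP; rewrite oner_eq0.
Qed.

Section Assembly.
Variables (F : finFieldType) (a : posroot).
Hypothesis two_neq0 : 2%:R != 0 :> F.
Local Notation x := (@xroot F).
Local Notation PG := (pattern_group (@xroot F)).
Let xF : chevalley_family x := xroot_family two_neq0.

Lemma Irr_U_pattern chi : Irr_U F a chi = Irr_pattern x [set: posroot] (kset a) a chi.
Proof.
have [/irrP[i ->]|nirr] := boolP (chi \in irr (UF4 F)); last first.
  rewrite /Irr_pattern Irr_overE -[LHS]/(_ && _).
  by rewrite (negPf nirr).
rewrite -[LHS]/(('chi_i \in irr (UF4 F)) && (root_support 'chi_i == [set a])).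
by rewrite /Irr_pattern Irr_overE (P_set1 xF) -(root_support_singleton xF i a) !mem_irr.
Qed.

Lemma Tker_E : Tker F a = PG (reduced_kernel a :|: [set a]).
Proof.
apply: (congr1 (fun S => PG S)).
by rewrite /reduced_kernel [RHS]setUC setUA.
Qed.

(** The exponent is |arm| + 1, one more than that of the minimal degree. *)
Lemma all_covers : covers x (source a) (reduced_kernel a) [set: posroot] (kset a) a
  (nth (0, 0) mida_table a).2.+1%N.
Proof.
have [aR|] := boolP (a \in R4normal).
  by apply: bijection_covers; apply: normal_root_bijection.
rewrite in_set negbK !inE !eqSS => /orP[]/eqP ea; rewrite ea.
  exact: covers_alpha20.
exact: covers_alpha22.
Qed.

Lemma nTS : Tker F a <| Sgrp F a.
Proof. by rewrite Tker_E; apply: (P_normal xF); apply: full_kernel_normal. Qed.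

Lemma nXS : Xker F a <| Sgrp F a.
Proof. exact: (P_normal xF (source_setD1_normal a)). Qed.

Lemma central_bijection : one_to_one
  [pred y : 'CF(Tbar F a) * 'CF(Xbar F a) | Irr (Tbar F a) y.1 && Irr_star (Xbar F a) y.2]
  (Irr_pattern x (source a) (reduced_kernel a) a)
  (@central_mul _ (Sgrp F a) (Tker F a) (Xker F a)).
Proof.
apply: (@central_mul_bijection _ (Sgrp F a) (PG (reduced_kernel a)) (Tker F a)
  (Xker F a) (PG [set a])).
- exact: nTS.
- exact: nXS.
- exact: (P_mono x (reduced_kernel_sub a)).
- exact: (P_TI_setD1 xF (source_closed a) (mem_source a) (source_setD1_normal a)).
- by rewrite Tker_E P_setU.
- exact: root_group_abelian xF a.
- apply: (P_comm_sub xF (reduced_kernel_normal a)); rewrite ?sub1set ?mem_source //.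
  by move=> _ b c /set1P-> _ abc; apply: (subsetP (kset_reduced a)); apply: kset_sum abc.
Qed.

Let d := (nth (0, 0) mida_table a).2%N.

Lemma Psi_covers :
  [/\ forall y, Irr (Tbar F a) y.1 && Irr_star (Xbar F a) y.2 -> Irr_U F a (Psi F a y),
      forall y z, Irr (Tbar F a) y.1 && Irr_star (Xbar F a) y.2 ->
        Irr (Tbar F a) z.1 && Irr_star (Xbar F a) z.2 -> Psi F a y = Psi F a z -> y = z
    & forall chi, Irr_U F a chi ->
        (exists2 y, Irr (Tbar F a) y.1 && Irr_star (Xbar F a) y.2 & Psi F a y = chi)
        \/ (#|F| ^ d.+1)%:R <= chi 1%g].
Proof.
have [intoI injI coverI] := all_covers; have [intoC injC coverC] := central_bijection.
split=> [y Dy|y z Dy Dz e|chi].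
- by rewrite Irr_U_pattern; apply: (intoI _ (intoC _ Dy)).
- by apply: (injC _ _ Dy Dz); apply: injI e; apply: intoC.
- rewrite Irr_U_pattern => /coverI[[phi /coverC[y Dy <-] <-]|]; [left|by right].
  by exists y.
Qed.

Lemma Psi_onto chi : a \in R4normal -> Irr_U F a chi ->
  exists2 y, Irr (Tbar F a) y.1 && Irr_star (Xbar F a) y.2 & Psi F a y = chi.
Proof.
move=> aR; have [_ _ ontoI] := normal_root_bijection xF aR.
have [_ _ ontoC] := central_bijection.
by rewrite Irr_U_pattern => /ontoI[phi /ontoC[y Dy <-] <-]; exists y.
Qed.

Lemma index_source : #|UF4 F : Sgrp F a| = (#|F| ^ d)%N.
Proof.
have F0 : (0 < #|F|)%N by apply/card_gt0P; exists 0.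
have cT : #|[set: posroot]| = (#|arm a| + #|source a|)%N.
  by rewrite cardsT /source -(cardsC (arm a)).
have clT : closed_pattern [set: posroot] by rewrite -pat_all; apply: pat_closed.
rewrite -divgS; last exact: (P_mono x (subsetT _)).
rewrite (card_P xF clT) (card_P xF (source_closed a)) -expnB ?subset_leq_card ?subsetT //.
by rewrite cT addnK card_arm.
Qed.

Lemma card_Xbar : #|Xbar F a| = #|F|.
Proof.
have F0 : (0 < #|F|)%N by apply/card_gt0P; exists 0.
rewrite card_quotient ?(normal_norm nXS) // -divgS ?(normal_sub nXS) //.
rewrite (card_P xF (source_closed a)) (card_P xF (normal_closed (source_setD1_normal a))).
rewrite -expnB ?subset_leq_card ?subD1set // [#|source a|](cardsD1 a) mem_source addnK.
by rewrite expn1.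
Qed.

Lemma Xbar_abelian : abelian (Xbar F a).
Proof.
have sd := P_TI_setD1 xF (source_closed a) (mem_source a) (source_setD1_normal a).
rewrite /= -(sdprodW sd : _ = Sgrp F a :> {set _}) quotientMidl quotient_abelian //.
exact: root_group_abelian xF a.
Qed.

Lemma card_Tbar_abelianization : #|Tbar F a : (Tbar F a)^`(1)%g| =
  (#|F| ^ (nth (0, 0) mida_table a).1)%N.
Proof.
rewrite -card_source_abelianization.
rewrite -(card_abelianization xF (source_closed a) (full_kernel_normal a)).
by rewrite -Tker_E.
Qed.
End Assembly.

Theorem proposition8p4 (p f q : nat) (F : finFieldType) :
  prime p -> (2 < p)%N -> (0 < f)%N -> q = (p ^ f)%N -> #|F| = q ->
  forall a : posroot,
    [/\ a \notin R4normal ->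
          one_to_one
            [pred x : 'CF(Tbar F a) * 'CF(Xbar F a) |
               Irr_lin (Tbar F a) x.1 && Irr_star (Xbar F a) x.2]
            (Irr_mida F a) (Psi F a),
        a \in R4normal ->
          one_to_one
            [pred x : 'CF(Tbar F a) * 'CF(Xbar F a) |
               Irr (Tbar F a) x.1 && Irr_star (Xbar F a) x.2]
            (Irr_U F a) (Psi F a)
      & let: (c, d) := nth (0, 0)%N mida_table a in
        #|[set i : Iirr (UF4 F) | Irr_mida F a 'chi_i]| = (q ^ c * (q - 1))%N /\
        (forall chi : 'CF(UF4 F), Irr_mida F a chi -> chi 1%g = (q ^ d)%:R)].
Proof.
move=> pr_p p_gt2 f_gt0 -> cardF a.
have two_neq0 : 2%:R != 0 :> F.
  apply: odd_card_two_neq0; rewrite cardF oddX orbC.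
  by case: (even_prime pr_p) p_gt2 => [->//|->].
have q_gt1 : (1 < #|F|)%N by apply: finNzRing_gt1.
have GU : Sgrp F a \subset UF4 F by apply: (P_mono (@xroot F) (subsetT _)).
have irrE chi : Irr_U F a chi -> chi \in irr (UF4 F) by case/andP.
have ntX : (1 < #|Xbar F a|)%N by rewrite card_Xbar.
have [intoP injP coverP] := Psi_covers a two_neq0.
have bij := @minimal_degree_bijection _ (UF4 F) (Sgrp F a) (Tker F a) (Xker F a) #|F| _
  (Irr_U F a) GU (Xbar_abelian a two_neq0) ntX q_gt1 (index_source a two_neq0) irrE
  intoP injP coverP.
have deg := @minimal_degree1 _ (UF4 F) (Sgrp F a) (Tker F a) (Xker F a) #|F| _
  (Irr_U F a) GU (Xbar_abelian a two_neq0) ntX q_gt1 (index_source a two_neq0) irrE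
  intoP coverP.
have card := @card_minimal_degree _ (UF4 F) (Sgrp F a) (Tker F a) (Xker F a) #|F| _
  (Irr_U F a) GU (Xbar_abelian a two_neq0) ntX q_gt1 (index_source a two_neq0) irrE
  intoP injP coverP.
rewrite card_Xbar // card_Tbar_abelianization // in card.
case: (nth _ mida_table a) deg card => c d deg card.
split; last by rewrite -cardF.
  by move=> _; apply: bij.
move=> aR.
by split=> // chi; apply: (Psi_onto two_neq0 aR).
Qed.
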